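(* Assume $X_0=\mathcal{Z}(a,E)$ and $U=\mathcal{Z}(c,G)$, where $a\in\mathbb{R}^n$, $c\in\mathbb{R}^m$, $E\in\mathbb{R}^{n\times p}$, $G\in\mathbb{R}^{m\times q}$ and $p,q\in\mathbb{Z}_+$. For each $N\in\mathbb{N}$, let $h=h^N=(t_f-t_0)/N$, $t_i=t^N_i=t_0+ih$ for $i\in\{0,\dots,N\}$, and define (superscripts $N$ suppressed) $b_0=a$, $F_0=E$ and, recursively for $i\in\{1,\dots,N\}$, $$m_{i-1}=\|(b_{i-1},F_{i-1})\|_\infty,\qquad K_i=hB(t_i)G,$$ $$b_i=\widetilde\phi(t_i,t_{i-1})b_{i-1}+hB(t_i)c,$$ $$F_i=\big(\widetilde\phi(t_i,t_{i-1})F_{i-1},\ K_i,\ (\alpha(h)+\theta(h)m_{i-1})\,\mathrm{id}\big),$$ $$(d_i,J_i)=\mathcal{E}\big((b_{i-1},F_{i-1}),\ (b_i,\widetilde\phi(t_i,t_{i-1})F_{i-1})\big),$$ $$H_i=\big(J_i,\ K_i,\ (\alpha(h)+\beta(h)+(\gamma(h)+\theta(h))m_{i-1})\,\mathrm{id}\big),$$ and denote $\Lambda^N_i=\mathcal{Z}(d^N_i,H^N_i)$. Then $\mathcal{R}([t^N_{i-1},t^N_i])\subseteq\Lambda^N_i$ for all $N\in\mathbb{N}$ and all $i\in\{1,\dots,N\}$, and $$d_H\big(\mathcal{R}([t^N_{i-1},t^N_i]),\Lambda^N_i\big)\le O(1/N)\quad\text{as }N\to\infty,\text{ uniformly with respect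 to }i.$$
   Context: Notation. $\mathbb{N}=\{1,2,\dots\}$, $\mathbb{Z}_+=\{0,1,2,\dots\}$, $\mathbb{R}_+=[0,\infty)$. All vector spaces $\mathbb{R}^k$ carry the maximum norm $\|x\|_\infty=\max_i|x_i|$, and matrices carry the induced operator norm (maximal absolute row sum); both are written $\|\cdot\|$ or $\|\cdot\|_\infty$. $\mathbb{B}\subseteq\mathbb{R}^n$ is the closed unit ball; $\|M\|=\sup_{x\in M}\|x\|$ for a nonempty set $M$; operations on sets are pointwise (Minkowski). $\mathrm{id}$ is the $n\times n$ identity matrix; $(M_1,M_2,\dots)$ denotes horizontal concatenation of matrices/column vectors with $n$ rows. The Hausdorff distance of nonempty bounded sets is $d_H(\Omega,\Gamma)=\inf\{\varepsilon>0:\Omega\subseteq\Gamma+\varepsilon\mathbb{B},\ \Gamma\subseteq\Omega+\varepsilon\mathbb{B}\}$. ''$f(N,i)\le O(1/N)$ as $N\to\infty$, uniformly w.r.t. $i$'' means: there exist $C\ge 0$, $N_0\in\mathbb{N}$ with $f(N,i)\le C/N$ for all $N\ge N_0$ and all admissible $i$. Zonotopes. For $c\in\mathbb{R}^k$, $G\in\mathbb{R}^{k\times q}$, $q\in\mathbb{Z}_+$: $\mathcal{Z}(c,G)=c+G[-1,1]^q$. The enclosure operator is, for $b,c\in\mathbb{R}^n$ and $F,G\in\mathbb{R}^{n\times p}$, $$\mathcal{E}((b,F),(c,G))=\Big(\tfrac{b+c}{2},\ \big(\tfrac{F+G}{2},\tfrac{b-c}{2},\tfrac{F-G}{2}\big)\Big)\in\mathbb{R}^n\times\mathbb{R}^{n\times(2p+1)}.$$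 System and standing assumptions. $n,m\in\mathbb{N}$, $t_0<t_f$ real. $X_0\subseteq\mathbb{R}^n$ and $U\subseteq\mathbb{R}^m$ are the uncertainty sets (nonempty, compact, convex). $A:[t_0,t_f]\to\mathbb{R}^{n\times n}$ and $B:[t_0,t_f]\to\mathbb{R}^{n\times m}$ are of class $C^1$, and $\|A(t)\|\le M_A$, $\|\dot A(t)\|\le M_{\dot A}$, $\|B(t)\|\le M_B$, $\|\dot B(t)\|\le M_{\dot B}$ for all $t\in[t_0,t_f]$, with real constants and $M_A>0$. The system is $\dot x(t)=A(t)x(t)+B(t)u(t)$. For $s\in[t_0,t_f]$, $p\in\mathbb{R}^n$ and integrable $u$, $\varphi(\cdot,s,p,u)$ is its unique absolutely continuous solution on $[t_0,t_f]$ (the equation holding for almost every $t$) with value $p$ at time $s$; $\phi(t,s)\in\mathbb{R}^{n\times n}$ is the transition matrix, $\phi(t,s)p=\varphi(t,s,p,0)$. Let $D=\{(t,s)\in[t_0,t_f]^2: t\ge s\}$. There are given a map $\widetilde\phi:D\to\mathbb{R}^{n\times n}$ and a monotonically increasing $\theta:\mathbb{R}_+\to\mathbb{R}_+$ with $\|\phi(t,s)-\widetilde\phi(t,s)\|\le\theta(t-s)$ for all $(t,s)\in D$ and $\theta(h)=O(h^2)$ as $h\to0$. Reachable sets and tubes. $\mathcal{R}(t)=\{\varphi(t,t_0,x_0,u): x_0\in X_0,\ u:[t_0,t]\to U\text{ measurable}\}$ and $\mathcal{R}([a,b])=\bigcup_{s\in[a,b]}\mathcal{R}(s)$ for $t_0\le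 a\le b\le t_f$. Auxiliary functions on $\mathbb{R}_+$: $r(s)=\exp(sM_A)-1-sM_A$, $\ \alpha(s)=r(s)\|U\|\dfrac{M_{\dot B}+M_AM_B}{M_A^2}$, $\ \beta(s)=s^2M_{\dot B}\|U\|$, $\ \gamma(s)=r(s)\Big(1+\dfrac{M_{\dot A}}{M_A^2}\Big)$. *)

(* Defs.v *)
From HB Require Import structures.
From mathcomp Require Import all_boot all_order all_algebra.
From mathcomp Require Import all_classical all_reals all_analysis.
From mathcomp Require Import measurable_realfun.

Set Implicit Arguments.
Unset Strict Implicit.
Unset Printing Implicit Defensive.

Import Order.TTheory GRing.Theory Num.Theory.
Import numFieldNormedType.Exports.

Local Open Scope classical_set_scope.
Local Open Scope ring_scope.

Section NormsAndSets.
Context {R : realType}.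

(* On column vectors the library norm `|x| is the maximum norm. On matrices it
   is the maximal absolute entry, not the operator norm induced by the maximum
   norm, which is the maximal absolute row sum [opnorm]. *)
Definition opnorm (k l : nat) (M : 'M[R]_(k, l)) : R :=
  \big[Num.max/0]_(i < k) \sum_(j < l) `|M i j|.

Definition setnorm (k : nat) (M : set 'cV[R]_k) : R :=
  sup [set `|x| | x in M].

Definition unit_ball {k : nat} : set 'cV[R]_k := [set x | `|x| <= 1].

Definition fattening (k : nat) (M : set 'cV[R]_k) (e : R) : set 'cV[R]_k :=
  [set y + e *: z | y in M & z in unit_ball].

(* The infimum is taken in the extended reals, so that it is +oo when no radius
   is admissible. *)
Definition hausdorff_dist (k : nat) (M L : set 'cV[R]_k) : \bar R :=
  ereal_inf [set e%:E | e in
    [set e : R | [/\ 0 < e, M `<=` fattening L e & L `<=` fattening M e]]].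

Definition zonotope (k q : nat) (c : 'cV[R]_k) (G : 'M[R]_(k, q)) :
    set 'cV[R]_k :=
  [set c + G *m x | x in [set x : 'cV[R]_q | forall j, -1 <= x j 0 <= 1]].

Definition enclosure (k p : nat) (bF cG : 'cV[R]_k * 'M[R]_(k, p)) :
    'cV[R]_k * 'M[R]_(k, p + (1 + p)) :=
  (2^-1 *: (bF.1 + cG.1),
   row_mx (2^-1 *: (bF.2 + cG.2))
     (row_mx (2^-1 *: (bF.1 - cG.1)) (2^-1 *: (bF.2 - cG.2)))).

End NormsAndSets.

Section ControlSystem.
Context {R : realType}.

(* [f] is of class C^1 on `[a, b] with derivative [f']; the difference
   quotients use points of `[a, b] only, so the derivative is one-sided at the
   end points and values of [f] outside `[a, b] are irrelevant. *)
Definition is_C1_on (V : normedModType R) (a b : R) (f f' : R -> V) : Prop :=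
  {within `[a, b], continuous f'} /\
  forall t, t \in `[a, b] ->
    (fun s => (s - t)^-1 *: (f s - f t)) @ within `[a, b] t^' --> f' t.

Definition absolutely_continuous (V : normedModType R) (a b : R) (x : R -> V) :
    Prop :=
  forall e : R, 0 < e -> exists2 d : R, 0 < d &
    forall (k : nat) (s t : 'I_k -> R),
      (forall i, [/\ a <= s i, s i <= t i & t i <= b]) ->
      trivIset setT (fun i => `]s i, t i[%classic) ->
      \sum_(i < k) (t i - s i) < d ->
      \sum_(i < k) `|x (t i) - x (s i)| < e.

(* Lebesgue measurability: the sigma-algebra on the source is the completion
   of the Borel sets. Measurability into R^k is measurability of every
   coordinate. *)
Definition lebesgue_measurable_on (k : nat) (D : set R) (u : R -> 'cV[R]_k) :
    Prop :=
  forall j : 'I_k,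
    measurable_fun
      (D : set (g_sigma_algebraType
                  (completed_algebra_gen (@lebesgue_measure R))))
      (fun s => u s j 0).

Context {n m : nat}.
Implicit Types (A : R -> 'M[R]_n) (B : R -> 'M[R]_(n, m)) (u : R -> 'cV[R]_m).

(* [x] is an absolutely continuous solution on `[a, b] of x' = A x + B u with
   value [p] at time [s]; it is unique on `[a, b], so "the solution" is
   rendered as a relation. The end points a, b form a null set. *)
Definition is_solution A B (a b s : R) (p : 'cV[R]_n) u (x : R -> 'cV[R]_n) :
    Prop :=
  [/\ absolutely_continuous a b x, x s = p &
      {ae lebesgue_measure, forall t : R, t \in `]a, b[ ->
        is_derive t (1 : R) x (A t *m x t + B t *m u t)}].

Definition is_transition_matrix A B (a b : R) (phi : R -> R -> 'M[R]_n) :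
    Prop :=
  forall (s : R) (p : 'cV[R]_n), s \in `[a, b] ->
    is_solution A B a b s p (fun=> 0) (fun t => phi t s *m p).

Definition reach A B (t0 : R) (X0 : set 'cV[R]_n) (U : set 'cV[R]_m) (t : R) :
    set 'cV[R]_n :=
  [set y | exists x0 u x,
    [/\ X0 x0,
        lebesgue_measurable_on `[t0, t] u,
        forall s, s \in `[t0, t] -> U (u s),
        is_solution A B t0 t t0 x0 u x &
        y = x t]].

Definition reach_tube A B (t0 : R) (X0 : set 'cV[R]_n) (U : set 'cV[R]_m)
    (a b : R) : set 'cV[R]_n :=
  \bigcup_(s in `[a, b]) reach A B t0 X0 U s.

End ControlSystem.

Section ErrorFunctions.
Context {R : realType}.
Implicit Types s nU MA MdA MB MdB : R.

Definition rfun MA s : R := expR (s * MA) - 1 - s * MA.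

Definition alpha nU MA MB MdB s : R :=
  rfun MA s * nU * ((MdB + MA * MB) / MA ^+ 2).

Definition beta nU MdB s : R := s ^+ 2 * MdB * nU.

Definition gamma MA MdA s : R := rfun MA s * (1 + MdA / MA ^+ 2).

End ErrorFunctions.

Section Algorithm.
Context {R : realType} {n m p q : nat}.
Variables (t0 tf : R) (B : R -> 'M[R]_(n, m)).
Variables (phit : R -> R -> 'M[R]_n) (theta al be ga : R -> R).
Variables (a : 'cV[R]_n) (E : 'M[R]_(n, p)) (c : 'cV[R]_m) (G : 'M[R]_(m, q)).
Variable N : nat.

Definition stepsize : R := (tf - t0) / N%:R.

Definition node (i : nat) : R := t0 + i%:R * stepsize.

Definition Kmat (i : nat) : 'M[R]_(n, q) := stepsize *: (B (node i) *m G).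

(* number of columns of F_i *)
Fixpoint ngens (i : nat) : nat :=
  if i is j.+1 then (ngens j + (q + n))%N else p.

(* [bF i] is the pair (b_i, F_i). *)
Fixpoint bF (i : nat) : 'cV[R]_n * 'M[R]_(n, ngens i) :=
  match i return 'cV[R]_n * 'M[R]_(n, ngens i) with
  | 0%N => (a, E)
  | j.+1 =>
    let b := (bF j).1 in
    let F := (bF j).2 in
    let P := phit (node j.+1) (node j) in
    let mj := opnorm (row_mx b F) in
    (P *m b + stepsize *: (B (node j.+1) *m c),
     row_mx (P *m F)
       (row_mx (Kmat j.+1) (al stepsize + theta stepsize * mj)%:M))
  end.

(* [dJ i] is the pair (d_i, J_i); it and [Lambda i] are meaningful for i >= 1
   only. *)
Definition dJ (i : nat) :=
  enclosure (bF i.-1)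
    ((bF i).1, phit (node i) (node i.-1) *m (bF i.-1).2).

Definition Lambda (i : nat) : set 'cV[R]_n :=
  let mi := opnorm (row_mx (bF i.-1).1 (bF i.-1).2) in
  zonotope (dJ i).1
    (row_mx (dJ i).2
      (row_mx (Kmat i)
        (al stepsize + be stepsize
           + (ga stepsize + theta stepsize) * mi)%:M)).

End Algorithm.

(* Main.v *)
Require Import Defs.
From HB Require Import structures.
From mathcomp Require Import all_boot all_order all_algebra.
From mathcomp Require Import all_classical all_reals all_analysis.
From mathcomp Require Import measurable_realfun.
From mathcomp Require Import ring lra.

Set Implicit Arguments.
Unset Strict Implicit.
Unset Printing Implicit Defensive.

Import Order.TTheory GRing.Theory Num.Theory.
Import numFieldNormedType.Exports.

Local Open Scope classical_set_scope.
Local Open Scope ring_scope.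

(** Let a solution [x] start a step at time [s] and let [te] be the right end of
    the step. Then [x t = phi t s *m x s + w t], where [w] vanishes at [s] and
    [w' = A w + B u] almost everywhere. Gronwall bounds [w] explicitly, so [w'] differs
    from [B te *m u t] by a known function of time, whose integral is at most
    [alpha]; the mean of [u] over the step stays in the compact convex set [U]
    ([control_response]). The free motion [phi t s *m x s] is, up to [gamma], the
    linear interpolation of its values at the ends of the step
    ([phi_interpolation]), and [theta] pays for replacing [phi] by [phit]. These
    errors are covered by the multiples of the identity appended to [F_i] and
    [H_i], so that both containments follow by induction over the nodes
    ([node_containment], [tube_containment]).

    Conversely, [alpha], [beta], [gamma] and [theta] are of order [h ^+ 2]
    ([small_step_rates]) and the norms [m_i] remain bounded by a discrete Gronwall
    argument ([size_bound]). A point of the zonotope [(b_i, F_i)] arises, up to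
    order [h ^+ 2], from a point of the preceding zonotope and one value [v] in [U];
    steering a true trajectory with the constant control [v] during the step
    ([reach_extend]) misses it by order [h ^+ 2] more. The errors accumulate to
    order [h] over all steps ([node_accuracy]). The point of [Lambda_i] with given
    coefficients is within order [h] of the point of the preceding zonotope with
    the same leading coefficients, since all remaining generators have size of
    order [h] ([enclosure_near]); this gives [tube_accuracy].

    Solutions are only absolutely continuous and controls only measurable. What
    is needed about them is a mean value theorem with values in a convex set,
    [ac_mean_value]; Gronwall's inequality and the estimates of [phi] follow from
    it. Solutions for constant controls are obtained by variation of constants,
    with [phi s t] as the inverse of [phi t s] ([constant_control_solution]). *)

(** * Pointwise derivatives and real induction *)

Lemma is_derive_approx (R : realType) (V : normedModType R) (x : R -> V)
    (c : R) (l : V) :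
  is_derive c (1 : R) x l <->
  forall e : R, 0 < e -> exists2 d : R, 0 < d &
    forall s, `|s - c| < d -> `|x s - x c - (s - c) *: l| <= e * `|s - c|.
Proof.
split.
- case=> dx <- e e0; move: dx => /derivable_nbhs.
  move=> /eqaddoP /(_ e e0); rewrite -nbhs_nearE => /nbhs_ballP[d /= d0 H].
  exists d => // s sd.
  have := H (s - c); rewrite /ball /= sub0r normrN => /(_ sd).
  rewrite !fctE /= opprD addrA.
  by rewrite /GRing.scale /= mulr1 subrK.
- move=> H.
  have cv : h^-1 *: ((x \o shift c) (h *: (1 : R)) - x c) @[h --> 0^'] --> l.
    apply/cvgrPdist_le => /= e e0.
    have [d d0 Hd] := H _ e0.
    near=> h.
    have h0 : h != 0 by near: h; exact: nbhs_dnbhs_neq.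
    have := Hd (h + c); rewrite addrK => /(_ _)/wrap[].
      near: h; apply: dnbhs0_lt; exact: d0.
    rewrite /GRing.scale /= mulr1 => Hh.
    rewrite -(ler_pM2l (x := `|h|)) ?normr_gt0// (mulrC _ e) -normrZ.
    rewrite scalerBr scalerA divff// scale1r.
    by rewrite distrC.
  split; first by apply/cvg_ex; exists l.
  by rewrite /derive; apply: cvg_lim => //; exact: norm_hausdorff.
Unshelve. all: by end_near. Qed.

(** The supremum of the points of [[s, t]] where [P] holds is itself reached, and
    then passed, by a step across it. *)
Lemma real_induction (R : realType) (s t : R) (P : R -> Prop) :
  s <= t -> P s ->
  (forall c, s <= c <= t -> exists2 d : R, 0 < d &
     forall a b, s <= a -> a <= c -> c <= b -> b <= t -> c - d < a ->
       b < c + d -> P a -> P b) ->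
  P t.
Proof.
move=> st Ps step.
pose T := [set x | s <= x <= t /\ P x].
have hs : has_sup T.
  by split; [exists s; rewrite /T /= lexx st|exists t => x [/andP[_ ->]]].
have Ts : T s by rewrite /T /= lexx st.
have sc : s <= sup T by apply: ub_le_sup => //; case: hs.
have ct : sup T <= t by apply: ge_sup; [exists s|move=> x [/andP[_ ->]]].
have [d d0 Hd] := step (sup T) ltac:(by rewrite sc ct).
have [a [/andP[sa at_] Pa] ca] := sup_adherent d0 hs.
have ac : a <= sup T.
  by apply: ub_le_sup; [case: hs|rewrite /T /= sa at_].
have step' b : sup T <= b -> b <= t -> b < sup T + d -> P b.
  by move=> cb bt bd; apply: (Hd a b).
have [<-|ct'] := eqVneq (sup T) t; first by apply: step' => //; lra.
exfalso.
have ctl : sup T < t by rewrite lt_neqAle ct' ct.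
pose b := Num.min t (sup T + d / 2).
have cb : sup T < b by rewrite /b lt_min ctl; lra.
have bt : b <= t by rewrite /b ge_min lexx.
have bd : b <= sup T + d / 2 by rewrite /b ge_min lexx orbT.
have Pb : P b by apply: step' => //; lra.
have : b <= sup T by apply: ub_le_sup; [case: hs|rewrite /T /=; split=> //; lra].
lra.
Qed.

(** * Mean values of absolutely continuous functions *)

Definition convex_in (R : realType) (V : lmodType R) (S : set V) : Prop :=
  forall u v (l : R), S u -> S v -> 0 <= l <= 1 -> S (l *: u + (1 - l) *: v).

Lemma convex_comb (R : realType) (V : lmodType R) (S : set V) (u v : V)
    (a b : R) :
  convex_in S -> S u -> S v -> 0 <= a -> 0 <= b ->
  exists2 w, S w & a *: u + b *: v = (a + b) *: w.
Proof.
move=> cS Su Sv a0 b0.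
have [ab0|ab0] := eqVneq (a + b) 0.
  have [-> ->] : a = 0 /\ b = 0 by lra.
  by exists u => //; rewrite !scale0r !addr0 scale0r.
exists ((a / (a + b)) *: u + (1 - a / (a + b)) *: v).
  apply: cS => //.
  have ab : 0 < a + b by rewrite lt_neqAle eq_sym ab0 addr_ge0.
  by rewrite divr_ge0 ?addr_ge0//= ler_pdivrMr// mul1r lerDl.
by rewrite scalerDr !scalerA; congr (_ *: _ + _ *: _); field.
Qed.

(** A partition fine enough for the gauge is built by real induction. A cell
    tagged at a point of the first kind contributes the multiple [(b - a) *: v]
    of an element of [S], and these add up to a multiple of one element by
    convexity; the other cells lie in [O] and are kept as the intervals
    [(f i, g i)], where [v0] stands in for the missing velocity. *)
Lemma partition_increment (R : realType) (V : normedModType R) (z : R -> V)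
    (rho : R -> R) (S : set V) (O : set R) (s t e C : R) (v0 : V) :
  s <= t -> 0 <= e -> convex_in S -> S v0 -> `|v0| <= C ->
  (forall a b, s <= a -> a <= b -> b <= t -> rho a <= rho b) ->
  (forall c, s <= c <= t -> exists2 d : R, 0 < d &
     (exists2 v, S v & forall a b, s <= a -> a <= c -> c <= b -> b <= t ->
        c - d < a -> b < c + d ->
        `|z b - z a - (b - a) *: v| <= rho b - rho a + e * (b - a)) \/
     (forall y, c - d < y < c + d -> O y)) ->
  exists k : nat, exists f g : nat -> R,
    [/\ forall i, (i < k)%N -> [/\ s <= f i, f i <= g i & g i <= t],
        forall i j, (i < j < k)%N -> g i <= f j,
        forall i, (i < k)%N -> `]f i, g i[ `<=` O &
        exists2 v, S v & `|z t - z s - (t - s) *: v| <=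
          rho t - rho s + e * (t - s)
          + \sum_(i < k) (`|z (g i) - z (f i)| + C * (g i - f i))].
Proof.
move=> st e0 cS Sv0 v0C rhoM gauge.
pose P x := exists k : nat, exists f g : nat -> R,
    [/\ forall i, (i < k)%N -> [/\ s <= f i, f i <= g i & g i <= x],
        forall i j, (i < j < k)%N -> g i <= f j,
        forall i, (i < k)%N -> `]f i, g i[ `<=` O &
        exists2 v, S v & `|z x - z s - (x - s) *: v| <=
          rho x - rho s + e * (x - s)
          + \sum_(i < k) (`|z (g i) - z (f i)| + C * (g i - f i))].
apply: (@real_induction R s t P) => // [|c cst].
  exists 0%N, (fun=> 0), (fun=> 0); split => //.
  exists v0 => //.
  by rewrite big_ord0 !subrr scale0r subr0 normr0 mulr0 !addr0.
have [d d0 gc] := gauge _ cst; exists d => // a b sa ac cb bt ca bc.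
move=> [k [f [g [fg gf fgO [v Sv vz]]]]].
case: gc => [[w Sw wz]|dO].
  exists k, f, g; split => //.
    by move=> i /fg[? ? ?]; split => //; lra.
  have [u Su Eu] := @convex_comb _ _ S v w (a - s) (b - a) cS Sv Sw
    ltac:(lra) ltac:(lra).
  exists u => //.
  have -> : z b - z s - (b - s) *: u =
      (z a - z s - (a - s) *: v) + (z b - z a - (b - a) *: w).
    have -> : b - s = a - s + (b - a) by ring.
    rewrite -Eu [RHS]addrACA -opprD; congr (_ - _).
    by rewrite [RHS]addrC addrA subrK.
  apply: le_trans (ler_normD _ _) _.
  have := wz a b sa ac cb bt ca bc; move: vz.
  by lra.
pose f' i := if i == k then a else f i.
pose g' i := if i == k then b else g i.
have f'E i : (i < k)%N -> f' i = f i by rewrite /f' => /ltn_eqF ->.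
have g'E i : (i < k)%N -> g' i = g i by rewrite /g' => /ltn_eqF ->.
have f'k : f' k = a by rewrite /f' eqxx.
have g'k : g' k = b by rewrite /g' eqxx.
exists k.+1, f', g'; split.
- move=> i; rewrite ltnS leq_eqVlt => /orP[/eqP ->|ik].
    by rewrite f'k g'k; split => //; lra.
  by rewrite f'E// g'E//; have [? ? ?] := fg _ ik; split => //; lra.
- move=> i j /andP[ij]; rewrite ltnS leq_eqVlt => /orP[/eqP jk|jk].
    rewrite jk f'k g'E -?jk//; have [] := fg i; first by rewrite -jk.
    by move=> _ _ ?; lra.
  by rewrite f'E// g'E ?(ltn_trans ij jk)//; apply: gf; rewrite ij jk.
- move=> i; rewrite ltnS leq_eqVlt => /orP[/eqP ->|ik].
    rewrite f'k g'k => y /=; rewrite in_itv /= => /andP[ay yb].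
    by apply: dO; lra.
  by rewrite f'E// g'E//; exact: fgO.
have [u Su Eu] := @convex_comb _ _ S v v0 (a - s) (b - a) cS Sv Sv0
  ltac:(lra) ltac:(lra).
exists u => //.
have -> : z b - z s - (b - s) *: u =
    (z a - z s - (a - s) *: v) + (z b - z a - (b - a) *: v0).
  have -> : b - s = a - s + (b - a) by ring.
  rewrite -Eu [RHS]addrACA -opprD; congr (_ - _).
  by rewrite [RHS]addrC addrA subrK.
apply: le_trans (ler_normD _ _) _.
rewrite big_ord_recr /= f'k g'k.
under eq_bigr => i _ do rewrite f'E// g'E//.
have : `|z b - z a - (b - a) *: v0| <= `|z b - z a| + C * (b - a).
  apply: le_trans (ler_normB _ _) _; rewrite lerD2l normrZ ger0_norm; last by lra.
  by rewrite mulrC ler_wpM2r//; lra.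
have := rhoM a b sa ltac:(lra) bt.
have : 0 <= e * (b - a) by rewrite mulr_ge0//; lra.
by move: vz; lra.
Qed.

Lemma disjoint_length_lt (R : realType) (O : set R) (d s t : R) k
    (f g : nat -> R) :
  measurable O -> (lebesgue_measure O < d%:E)%E ->
  (forall i, (i < k)%N -> [/\ s <= f i, f i <= g i & g i <= t]) ->
  (forall i j, (i < j < k)%N -> g i <= f j) ->
  (forall i, (i < k)%N -> `]f i, g i[ `<=` O) ->
  trivIset `I_k (fun i => `]f i, g i[%classic) /\ \sum_(i < k) (g i - f i) < d.
Proof.
move=> mO Od fg gf fgO.
have tI : trivIset `I_k (fun i => `]f i, g i[%classic).
  clear mO Od; move=> i j /= ik jk [y [/=]]; rewrite !in_itv/= => /andP[fi gi] /andP[fj gj].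
  have [ij|ij|//] := ltngtP i j.
    by have := gf i j; rewrite ij jk => /(_ isT) ?; exfalso; lra.
  by have := gf j i; rewrite ij ik => /(_ isT) ?; exfalso; lra.
split => //; rewrite -lte_fin; apply: le_lt_trans Od.
have len i : (i < k)%N ->
    lebesgue_measure (`]f i, g i[%classic : set R) = (g i - f i)%:E.
  move=> ik; have [_ fgi _] := fg i ik.
  rewrite lebesgue_measure_itv /= lte_fin.
  case: ltP => // gfi; congr EFin.
  by apply/eqP; rewrite eq_sym subr_eq0 eq_le gfi fgi.
have E : (\sum_(i < k) (g i - f i))%:E =
    lebesgue_measure (\big[setU/set0]_(i < k) (`]f i, g i[%classic : set R)).
  rewrite (@measure_semi_additive_ord_I _ _ _ lebesgue_measure
    (fun i => `]f i, g i[%classic : set R)) //.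
    by rewrite -sumEFin; apply: eq_bigr => i _; exact/esym/len.
  by apply: bigsetU_measurable => i _; exact: measurable_itv.
rewrite E le_measure ?inE//.
  by apply: bigsetU_measurable => i _; exact: measurable_itv.
elim/big_ind : _ => [|A B AO BO|i _]; first exact: sub0set.
  by rewrite subUset.
exact: fgO.
Qed.

Lemma null_set_cover (R : realType) (N : set R) (d : R) :
  (@lebesgue_measure R).-negligible N -> 0 < d ->
  exists O : set R, [/\ open O, N `<=` O & (lebesgue_measure O < d%:E)%E].
Proof.
move=> [M [mM M0 NM]] d0.
have [|U [oU MU Ud]] := lebesgue_regularity_outer mM _ d0.
  by move: M0 => /= ->; rewrite ltry.
exists U; split => //; first exact: subset_trans MU.
rewrite -(setDUK MU) measureU //; last 2 first.
- by apply: measurableD => //; exact: open_measurable.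
- exact: setDIK.
by move: M0 => /= ->; rewrite add0e.
Qed.

(** The points without a suitable derivative form a null set, which is covered by
    an open set [O] so small that the total increment of [z] over disjoint
    intervals inside [O] is negligible by absolute continuity. All other points
    have a gauge given by the derivatives of [z] and [rho], and
    [partition_increment] applies. *)
Lemma ac_mean_value (R : realType) (V : normedModType R) (z : R -> V)
    (rho drho : R -> R) (S : set V) (s t e : R) :
  s <= t -> absolutely_continuous s t z -> convex_in S -> S !=set0 ->
  (forall a b, s <= a -> a <= b -> b <= t -> rho a <= rho b) ->
  (forall c, is_derive c (1 : R) rho (drho c)) ->
  {ae lebesgue_measure, forall c : R, c \in `]s, t[ ->
     exists l v, [/\ is_derive c (1 : R) z l, S v & `|l - v| <= drho c]} ->
  0 < e ->
  exists2 v, S v & `|z t - z s - (t - s) *: v| <= rho t - rho s + e.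
Proof.
move=> st acz cS [v0 Sv0] rhoM drhoP aez e0.
(* The increments of [z] in [O], the stand-in velocity [v0] on [O], and the
   linear approximations outside [O] take at most a quarter of [e] each. *)
have [d1 d10 Hd1] := acz (e / 4) ltac:(by rewrite divr_gt0).
pose C := `|v0|.
have C0 : 0 <= C by exact: normr_ge0.
pose d := Num.min d1 (e / (4 * (C + 1))).
have C1 : 0 < 4 * (C + 1) by lra.
have d0 : 0 < d by rewrite /d lt_min d10 divr_gt0.
have Cd : C * d <= e / 4.
  apply: (@le_trans _ _ ((C + 1) * (e / (4 * (C + 1))))).
    by apply: ler_pM => //; [exact: ltW|lra|rewrite /d ge_min lexx orbT].
  by rewrite le_eqVlt; apply/orP; left; apply/eqP; field; lra.
pose e1 := e / (4 * (t - s + 1)).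
have e10 : 0 < e1 by rewrite divr_gt0//; lra.
have e1st : e1 * (t - s) <= e / 4.
  have -> : e / 4 = e1 * (t - s + 1) by rewrite /e1; field; lra.
  by rewrite ler_pM2l//; lra.
have negN : (@lebesgue_measure R).-negligible
    (~` [set c | c \in `]s, t[ ->
     exists l v, [/\ is_derive c (1 : R) z l, S v & `|l - v| <= drho c]]
     `|` ([set s] `|` [set t])).
  have pt (x : R) : (@lebesgue_measure R).-negligible [set x].
    by exists [set x]; split => //=; rewrite lebesgue_measure_set1.
  by apply: negligibleU; [exact: aez|exact: negligibleU].
have [ O [oO NO Od]] := null_set_cover negN d0.
have short := disjoint_length_lt (open_measurable oO) Od; clear Od.
have [|k [f [g [fg gf fgO [v Sv vz]]]]] :=
    @partition_increment R V z rho S O s t e1 C v0 st (ltW e10) cS Sv0 (lexx _)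
      rhoM.
  move=> c cst.
  have [Oc|nOc] := pselect (O c).
    have /nbhs_ballP[r /= r0 rO] := open_nbhs_nbhs (conj oO Oc).
    exists r => //; right=> y cy; apply: rO; rewrite /ball /=.
    by rewrite ltr_norml; lra.
  have cN : ~ (~` [set c | c \in `]s, t[ ->
     exists l v, [/\ is_derive c (1 : R) z l, S v & `|l - v| <= drho c]]
     `|` ([set s] `|` [set t])) c by move=> /NO.
  have [l [v [zl Sv lv]]] : exists l v,
      [/\ is_derive c (1 : R) z l, S v & `|l - v| <= drho c].
    apply: contrapT => nex; apply: cN.
    have [cs|cs] := eqVneq c s; first by right; left.
    have [ct|ct] := eqVneq c t; first by right; right.
    left => /(_ _)/wrap[]//; rewrite in_itv /=.
    by move: cst; rewrite !lt_neqAle ct eq_sym cs.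
  have [da da0 Ha] := (is_derive_approx _ _ _).1 zl (e1 / 2) ltac:(lra).
  have [db db0 Hb] := (is_derive_approx _ _ _).1 (drhoP c) (e1 / 2) ltac:(lra).
  exists (Num.min da db); first by rewrite lt_min da0.
  left; exists v => // a b sa ac cb bt ca bc.
  have mda : Num.min da db <= da by rewrite ge_min lexx.
  have mdb : Num.min da db <= db by rewrite ge_min lexx orbT.
  have nb : `|b - c| = b - c by rewrite ger0_norm//; lra.
  have na : `|a - c| = c - a by rewrite ler0_norm//; lra.
  have Hzb := Ha b ltac:(rewrite nb; lra).
  have Hza := Ha a ltac:(rewrite na; lra).
  have := Hb b ltac:(rewrite nb; lra).
  have := Hb a ltac:(rewrite na; lra).
  rewrite nb na in Hzb Hza *; rewrite /GRing.scale /= !ler_norml.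
  move=> /andP[ra1 ra2] /andP[rb1 rb2].
  have -> : z b - z a - (b - a) *: v = (z b - z c - (b - c) *: l)
     - (z a - z c - (a - c) *: l) + (b - a) *: (l - v).
    have -> : b - a = (b - c) - (a - c) by ring.
    rewrite scalerBr addrA; congr (_ - _).
    rewrite [in RHS]opprD [X in _ = X + _]addrACA -opprD opprB.
    by rewrite (addrA (z b - z c)) subrK -scalerBl subrK.
  apply: le_trans (ler_normD _ _) _.
  have N1 := ler_normB (z b - z c - (b - c) *: l) (z a - z c - (a - c) *: l).
  have N2 : `|(b - a) *: (l - v)| <= (b - a) * drho c.
    by rewrite normrZ ger0_norm ?ler_wpM2l//; lra.
  lra.
have [tI sumd] := short _ _ _ _ _ fg gf fgO.
exists v => //.
have : \sum_(i < k) `|z (g i) - z (f i)| < e / 4.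
  apply: (Hd1 k (fun i => f i) (fun i => g i)).
  - by move=> i; apply: fg.
  - move=> i j _ _ ij; apply/val_inj; apply: tI => //=.
  - by apply: lt_le_trans sumd _; rewrite /d ge_min lexx.
have : \sum_(i < k) C * (g i - f i) <= e / 4.
  rewrite -mulr_sumr; apply: le_trans Cd; rewrite ler_wpM2l//.
  exact: ltW.
move: vz; rewrite big_split /=; lra.
Qed.

(** * Maximum norm and zonotopes *)

Section MaxNorm.
Context {R : realType}.

Lemma cV_entry_le (k : nat) (v : 'cV[R]_k) i : `|v i 0| <= `|v|.
Proof.
rewrite [leRHS](mx_normrE v).
exact: (le_bigmax _ (fun ij => `|v ij.1 ij.2|) (i, 0)).
Qed.

Lemma cV_norm_le (k : nat) (v : 'cV[R]_k) (K : R) :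
  0 <= K -> (forall i, `|v i 0| <= K) -> `|v| <= K.
Proof.
move=> K0 vK; rewrite [leLHS](mx_normrE v); apply: bigmax_le => // -[i j] _ /=.
by rewrite ord1.
Qed.

Lemma opnorm_ge0 (k l : nat) (M : 'M[R]_(k, l)) : 0 <= opnorm M.
Proof. exact: bigmax_ge_id. Qed.

Lemma norm_mulmx_le (k l : nat) (M : 'M[R]_(k, l)) (v : 'cV[R]_l) :
  `|M *m v| <= opnorm M * `|v|.
Proof.
apply: cV_norm_le => [|i]; first by rewrite mulr_ge0 ?opnorm_ge0.
rewrite mxE; apply: le_trans (ler_norm_sum _ _ _) _.
apply: (@le_trans _ _ ((\sum_j `|M i j|) * `|v|)).
  rewrite mulr_suml; apply: ler_sum => j _.
  by rewrite normrM ler_wpM2l// cV_entry_le.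
rewrite ler_wpM2r//.
exact: (le_bigmax _ (fun i => \sum_(j < l) `|M i j|) i).
Qed.

Lemma norm_mulmx_le_trans (k l : nat) (M : 'M[R]_(k, l)) (v : 'cV[R]_l)
    (K L : R) : opnorm M <= K -> `|v| <= L -> `|M *m v| <= K * L.
Proof.
move=> MK vL; apply: le_trans (norm_mulmx_le M v) _.
by apply: ler_pM => //; exact: opnorm_ge0.
Qed.

(** The sign vector of a row turns its absolute sum into a value of the map. *)
Lemma opnorm_le (k l : nat) (M : 'M[R]_(k, l)) (K : R) :
  0 <= K -> (forall v : 'cV[R]_l, `|v| <= 1 -> `|M *m v| <= K) -> opnorm M <= K.
Proof.
move=> K0 MK; apply: bigmax_le => // i _.
pose v : 'cV[R]_l := \col_j Num.sg (M i j).
have v1 : `|v| <= 1.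
  apply: cV_norm_le => // j; rewrite mxE.
  by rewrite normr_sg lern1 leq_b1.
apply: le_trans (MK v v1); apply: le_trans (cV_entry_le _ i).
rewrite mxE; apply: le_trans (ler_norm _).
by apply: ler_sum => j _; rewrite mxE mulrC -normrEsg.
Qed.

Lemma norm_col_mx_le (k l : nat) (u : 'cV[R]_k) (v : 'cV[R]_l) (K : R) :
  `|u| <= K -> `|v| <= K -> `|col_mx u v| <= K.
Proof.
move=> uK vK; have K0 : 0 <= K by exact: le_trans uK.
apply: cV_norm_le => // i; rewrite mxE; case: splitP => j _.
  by apply: le_trans uK; rewrite cV_entry_le.
by apply: le_trans vK; rewrite cV_entry_le.
Qed.

Lemma norm_usubmx_le (k l : nat) (v : 'cV[R]_(k + l)) : `|usubmx v| <= `|v|.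
Proof. by apply: cV_norm_le => // i; rewrite mxE cV_entry_le. Qed.

Lemma norm_dsubmx_le (k l : nat) (v : 'cV[R]_(k + l)) : `|dsubmx v| <= `|v|.
Proof. by apply: cV_norm_le => // i; rewrite mxE cV_entry_le. Qed.

End MaxNorm.

Section Zonotopes.
Context {R : realType}.

Lemma zonotopeP (k q : nat) (c : 'cV[R]_k) (G : 'M[R]_(k, q)) y :
  zonotope c G y <-> exists2 x : 'cV[R]_q, `|x| <= 1 & y = c + G *m x.
Proof.
split=> [[x /= x1 <-]|[x x1 ->]]; exists x => //=.
  by apply: cV_norm_le => // i; rewrite ler_norml.
by move=> j; rewrite -ler_norml (le_trans (cV_entry_le _ _)).
Qed.

Lemma zonotope_nonempty (k q : nat) (c : 'cV[R]_k) (G : 'M[R]_(k, q)) :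
  zonotope c G c.
Proof. by apply/zonotopeP; exists 0; rewrite ?normr0 ?mulmx0 ?addr0. Qed.

Lemma zonotope_norm_le (k q : nat) (c : 'cV[R]_k) (G : 'M[R]_(k, q)) y :
  zonotope c G y -> `|y| <= opnorm (row_mx c G).
Proof.
move=> /zonotopeP[x x1 ->].
have -> : c + G *m x = row_mx c G *m col_mx (1%:M : 'M[R]_1) x.
  by rewrite mul_row_col mulmx1.
rewrite -[leRHS]mulr1; apply: norm_mulmx_le_trans => //.
apply: norm_col_mx_le => //; apply: cV_norm_le => // i.
by rewrite ord1 mxE normr1.
Qed.

Lemma zonotope_row_mx (k q r : nat) (c : 'cV[R]_k) (F : 'M[R]_(k, q))
    (G : 'M[R]_(k, r)) y :
  zonotope c (row_mx F G) y <->
  exists2 x : 'cV[R]_q, `|x| <= 1 & zonotope (c + F *m x) G y.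
Proof.
split=> [/zonotopeP[x x1 ->]|[x x1 /zonotopeP[z z1 ->]]].
  exists (usubmx x); first exact: le_trans (norm_usubmx_le _) x1.
  apply/zonotopeP; exists (dsubmx x); first exact: le_trans (norm_dsubmx_le _) x1.
  by rewrite -[in LHS](vsubmxK x) mul_row_col addrA.
apply/zonotopeP; exists (col_mx x z); first exact: norm_col_mx_le.
by rewrite mul_row_col addrA.
Qed.

Lemma zonotope_scalar_mx (k : nat) (c : 'cV[R]_k) (r : R) y :
  0 <= r -> zonotope c (r%:M : 'M[R]_k) y <-> `|y - c| <= r.
Proof.
move=> r0; split=> [/zonotopeP[x x1 ->]|yc].
  rewrite addrC addKr mul_scalar_mx normrZ ger0_norm//.
  by rewrite ler_piMr.
apply/zonotopeP; have [r0'|rn0] := eqVneq r 0.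
  exists 0; rewrite ?normr0// mulmx0 addr0; apply/eqP.
  by rewrite -subr_eq0 -normr_le0 -r0'.
exists (r^-1 *: (y - c)).
  rewrite normrZ ger0_norm ?invr_ge0// mulrC ler_pdivrMr ?mul1r//.
  by rewrite lt_neqAle eq_sym rn0.
by rewrite mul_scalar_mx scalerA divff// scale1r addrC subrK.
Qed.

Lemma convex_zonotope (k q : nat) (c : 'cV[R]_k) (G : 'M[R]_(k, q)) :
  convex_in (zonotope c G).
Proof.
move=> u v l /zonotopeP[x x1 ->] /zonotopeP[y y1 ->] /andP[l0 l1].
apply/zonotopeP; exists (l *: x + (1 - l) *: y).
  apply: le_trans (ler_normD _ _) _; rewrite !normrZ !ger0_norm ?subr_ge0//.
  have : l * `|x| <= l by rewrite ler_piMr.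
  have : (1 - l) * `|y| <= 1 - l by rewrite ler_piMr// subr_ge0.
  lra.
rewrite !scalerDr !mulmxDr -!scalemxAr addrACA; congr (_ + _).
by rewrite -scalerDl addrC subrK scale1r.
Qed.

Lemma norm_trmx_rV (k : nat) (x : 'rV[R]_k) : `|x^T| = `|x|.
Proof.
apply/eqP; rewrite eq_le; apply/andP; split.
  apply: cV_norm_le => // i; rewrite mxE [leRHS](mx_normrE x).
  exact: (le_bigmax _ (fun ij => `|x ij.1 ij.2|) (0, i)).
rewrite [leLHS](mx_normrE x); apply: bigmax_le => // -[i j] _ /=.
by rewrite (ord1 i) (le_trans _ (cV_entry_le _ j))// mxE.
Qed.

(** The distance to [y] attains its minimum on the compact parameter cube. *)
Lemma zonotope_attains (k l q : nat) (c : 'cV[R]_k) (G : 'M[R]_(k, q))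
    (M : 'M[R]_(l, k)) (y : 'cV[R]_l) (r : R) :
  (forall e : R, 0 < e ->
     exists2 v, zonotope c G v & `|y - M *m v| <= r + e) ->
  exists2 v, zonotope c G v & `|y - M *m v| <= r.
Proof.
move=> H.
pose f (x : 'rV[R]_q) := `|y - M *m (c + G *m x^T)|.
pose A := [set x : 'rV[R]_q | forall i, `[(- 1 : R), 1]%classic (x ord0 i)].
have cA : compact A.
  apply: (@rV_compact _ _ (fun=> `[(- 1 : R), 1]%classic)) => i.
  exact: segment_compact.
have A0 : A !=set0.
  by exists 0 => i /=; rewrite mxE in_itv /=; lra.
have AE x : A x <-> `|x^T| <= 1.
  split=> [Ax|x1 i /=].
    apply: cV_norm_le => // i; have := Ax i.
    by rewrite /= in_itv /= mxE ler_norml.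
  have := le_trans (cV_entry_le _ i) x1.
  by rewrite in_itv /= mxE ler_norml.
have cf : continuous f.
  move=> x; apply/(@cvgrPdist_le _ _ _ _ (nbhs_filter x)) => /= e e0.
  have K0 : 0 < opnorm M * opnorm G + 1 by rewrite ltr_wpDl// mulr_ge0 ?opnorm_ge0.
  apply/nbhs_ballP; exists (e / (opnorm M * opnorm G + 1)) => /=.
    by rewrite divr_gt0.
  move=> z; rewrite -ball_normE /= => xz.
  apply: le_trans (ler_dist_dist _ _) _.
  rewrite opprB addrC addrA subrK -mulmxBr opprD addrACA subrr add0r -mulmxBr.
  apply: le_trans (norm_mulmx_le _ _) _.
  apply: le_trans (ler_wpM2l (opnorm_ge0 _) (norm_mulmx_le _ _)) _.
  have -> : z^T - x^T = (z - x)^T by apply/matrixP => i j; rewrite !mxE.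
  rewrite norm_trmx_rV distrC mulrA.
  apply: (@le_trans _ _ ((opnorm M * opnorm G + 1) * `|x - z|)).
    by rewrite ler_wpM2r// lerDl.
  by rewrite mulrC -ler_pdivlMr//; exact: ltW.
have [x xA xmin] := EVT_min_rV A0 cA (continuous_subspaceT cf).
rewrite inE in xA.
exists (c + G *m x^T); first by apply/zonotopeP; exists x^T => //; exact/AE.
apply/ler_addgt0Pr => e e0.
have [v /zonotopeP[z z1 ->] ve] := H _ e0.
apply: le_trans ve; have := xmin z^T; rewrite /f trmxK; apply.
by rewrite inE; apply/AE; rewrite trmxK.
Qed.

Lemma zonotope_setnorm (k q : nat) (c : 'cV[R]_k) (G : 'M[R]_(k, q)) y :
  zonotope c G y -> `|y| <= setnorm (zonotope c G).
Proof.
move=> zy; apply: ub_le_sup; last by exists y.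
by exists (opnorm (row_mx c G)) => _ [x /zonotope_norm_le ? <-].
Qed.

Lemma setnorm_zonotope_ge0 (k q : nat) (c : 'cV[R]_k) (G : 'M[R]_(k, q)) :
  0 <= setnorm (zonotope c G).
Proof.
by apply: le_trans (zonotope_setnorm (zonotope_nonempty c G)).
Qed.

End Zonotopes.

(** * C^1 functions and absolutely continuous functions *)

Lemma c1_approx (R : realType) (V : normedModType R) (a b : R) (f f' : R -> V)
    (c e : R) :
  is_C1_on a b f f' -> a <= c <= b -> 0 < e ->
  exists2 d : R, 0 < d & forall x, a <= x <= b -> `|x - c| < d ->
    `|f x - f c - (x - c) *: f' c| <= e * `|x - c|.
Proof.
move=> [_ H] cab e0; have := H c; rewrite in_itv /= => /(_ cab) {}H.
move/cvgrPdist_le: H => /(_ e e0).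
rewrite near_withinE /dnbhs near_withinE => /nbhs_ballP[d /= d0 Hd].
exists d => // x xab xc.
have [->|xnc] := eqVneq x c; first by rewrite !subrr scale0r subr0 !normr0 mulr0.
have := Hd x; rewrite /ball /= distrC => /(_ xc xnc).
rewrite in_itv /= => /(_ xab) Hx.
rewrite -subr_eq0 in xnc.
have -> : f x - f c - (x - c) *: f' c =
    (x - c) *: ((x - c)^-1 *: (f x - f c) - f' c).
  by rewrite scalerBr scalerA divff// scale1r.
by rewrite normrZ mulrC ler_wpM2r// distrC.
Qed.

Lemma opnorm_le_norm (R : realType) (k l : nat) (M : 'M[R]_(k, l)) :
  opnorm M <= l%:R * `|M|.
Proof.
apply: bigmax_le => [|i _]; first by rewrite mulr_ge0.
apply: (@le_trans _ _ (\sum_(j < l) `|M|)).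
  apply: ler_sum => j _; rewrite [leRHS](mx_normrE M).
  exact: (le_bigmax _ (fun ij => `|M ij.1 ij.2|) (i, j)).
by rewrite sumr_const card_ord mulr_natl.
Qed.

(** Real induction needs only the difference quotients inside [[a, b]], hence
    copes with the one-sided derivatives at the end points. *)
Lemma c1_lipschitz (R : realType) (k l : nat) (a b K : R)
    (f f' : R -> 'M[R]_(k, l)) :
  is_C1_on a b f f' -> (forall t, t \in `[a, b] -> opnorm (f' t) <= K) ->
  forall s t (v : 'cV[R]_l), a <= s -> s <= t -> t <= b ->
    `|(f t - f s) *m v| <= K * (t - s) * `|v|.
Proof.
move=> fC1 f'K s t v as_ st tb.
apply/ler_addgt0Pr => e e0.
pose e1 := e / ((t - s + 1) * (l%:R * `|v| + 1)).
have lv0 : 0 <= l%:R * `|v| by rewrite mulr_ge0.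
have e10 : 0 < e1 by rewrite divr_gt0// mulr_gt0//; lra.
have e1E : e1 * (l%:R * `|v|) * (t - s) <= e.
  have -> : e = e1 * (l%:R * `|v| + 1) * (t - s + 1).
    by rewrite /e1; field; apply/andP; split; lra.
  apply: ler_pM; [by rewrite mulr_ge0 ?(ltW e10)|lra| |lra].
  by rewrite ler_wpM2l ?(ltW e10)//; lra.
suff : `|(f t - f s) *m v| <= (K * `|v| + e1 * (l%:R * `|v|)) * (t - s) by lra.
apply: (@real_induction R s t
  (fun x => `|(f x - f s) *m v| <= (K * `|v| + e1 * (l%:R * `|v|)) * (x - s))) => //.
  by rewrite subrr mul0mx normr0 subrr mulr0.
move=> c cst.
have [d d0 Hd] := @c1_approx _ _ a b f f' c e1 fC1 ltac:(lra) e10.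
exists d => // x y sx xc cy yt cx yc IH.
have nx : `|x - c| = c - x by rewrite ler0_norm; lra.
have ny : `|y - c| = y - c by rewrite ger0_norm; lra.
have := Hd x ltac:(lra); rewrite nx => /(_ ltac:(lra)) Hx.
have := Hd y ltac:(lra); rewrite ny => /(_ ltac:(lra)) Hy.
set ex := f x - f c - (x - c) *: f' c in Hx.
set ey := f y - f c - (y - c) *: f' c in Hy.
have -> : (f y - f s) *m v =
    (f x - f s) *m v + ((y - x) *: (f' c *m v) + ey *m v - ex *m v).
  rewrite scalemxAl -mulmxDl -mulmxBl -mulmxDl; congr (_ *m _).
  by apply/matrixP => i j; rewrite /ex /ey !mxE; ring.
have B (M : 'M[R]_(k, l)) (r : R) : `|M| <= e1 * r -> `|M *m v| <= e1 * (l%:R * `|v|) * r.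
  move=> Mr; apply: le_trans (norm_mulmx_le _ _) _.
  apply: le_trans (ler_wpM2r (normr_ge0 _) (opnorm_le_norm _)) _.
  have := ler_wpM2l lv0 Mr; lra.
have N1 := B _ _ Hx; have N2 := B _ _ Hy.
have N3 : `|(y - x) *: (f' c *m v)| <= (y - x) * (K * `|v|).
  rewrite normrZ ger0_norm; last by lra.
  rewrite ler_wpM2l//; first by lra.
  apply: norm_mulmx_le_trans => //; apply: f'K; rewrite in_itv /=; lra.
apply: le_trans (ler_normD _ _) _.
have := ler_normB ((y - x) *: (f' c *m v) + ey *m v) (ex *m v).
have := ler_normD ((y - x) *: (f' c *m v)) (ey *m v).
lra.
Qed.

Section AbsoluteContinuity.
Context {R : realType} {V : normedModType R}.
Implicit Types (x y : R -> V) (a b c d : R).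

Lemma ac_sub a b x y : absolutely_continuous a b x ->
  absolutely_continuous a b y -> absolutely_continuous a b (fun s => x s - y s).
Proof.
move=> acx acy e e0.
have [d1 d10 H1] := acx (e / 2) ltac:(lra).
have [d2 d20 H2] := acy (e / 2) ltac:(lra).
exists (Num.min d1 d2); first by rewrite lt_min d10.
move=> k s t st tI; rewrite lt_min => /andP[/(H1 _ _ _ st tI) L1 /(H2 _ _ _ st tI) L2].
apply: (@le_lt_trans _ _ (\sum_(i < k) `|x (t i) - x (s i)|
    + \sum_(i < k) `|y (t i) - y (s i)|)); last by lra.
rewrite -big_split /=; apply: ler_sum => i _.
by rewrite opprD addrACA -opprD; exact: ler_normB.
Qed.

Lemma ac_restrict a b c d x : a <= c -> d <= b ->
  absolutely_continuous a b x -> absolutely_continuous c d x.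
Proof.
move=> ac db acx e e0; have [r r0 H] := acx e e0; exists r => // k s t st.
by apply: H => i; have [? ? ?] := st i; split => //; lra.
Qed.

Lemma ac_ext a b x y : (forall s, a <= s <= b -> x s = y s) ->
  absolutely_continuous a b x -> absolutely_continuous a b y.
Proof.
move=> xy acx e e0; have [r r0 H] := acx e e0; exists r => // k s t st tI rs.
have := H k s t st tI rs; congr (_ < _); apply: eq_bigr => i _.
by have [? ? ?] := st i; rewrite !xy//; lra.
Qed.

Lemma ac_lipschitz a b x (K : R) : 0 <= K ->
  (forall s t, a <= s -> s <= t -> t <= b -> `|x t - x s| <= K * (t - s)) ->
  absolutely_continuous a b x.
Proof.
move=> K0 xK e e0; exists (e / (K + 1)); first by rewrite divr_gt0//; lra.
move=> k s t st _; rewrite ltr_pdivlMr; last by lra.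
apply: le_lt_trans; rewrite mulr_suml; apply: ler_sum => i _.
have [a1 a2 a3] := st i; apply: le_trans (xK _ _ a1 a2 a3) _.
by have := ler_wpM2l K0 a2; lra.
Qed.

(** A family of disjoint intervals is cut at [b] by taking minima and maxima with
    [b]; both halves are again disjoint families. *)
Lemma ac_glue a b c x : a <= b -> b <= c -> absolutely_continuous a b x ->
  absolutely_continuous b c x -> absolutely_continuous a c x.
Proof.
move=> ab bc acx acy e e0.
have [d1 d10 H1] := acx (e / 2) ltac:(lra).
have [d2 d20 H2] := acy (e / 2) ltac:(lra).
exists (Num.min d1 d2); first by rewrite lt_min d10.
move=> k s t st tI; rewrite lt_min => /andP[L1 L2].
have K1 : \sum_(i < k) `|x (Num.min (t i) b) - x (Num.min (s i) b)| < e / 2.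
  apply: (H1 k (fun i => Num.min (s i) b) (fun i => Num.min (t i) b)).
  - move=> i; have [? ? ?] := st i.
    by rewrite !le_min !ge_min; split; rewrite ?lexx ?orbT//; lra.
  - move=> i j _ _ [y [/=]]; rewrite !in_itv /= !lt_min !gt_min.
    move=> /andP[si /andP[ti yb]] /andP[sj /andP[tj _]].
    apply: tI => //; exists y; split; rewrite /= in_itv /= ?ti ?tj andbT.
      by case/orP: si => //; lra.
    by case/orP: sj => //; lra.
  - apply: le_lt_trans L1; apply: ler_sum => i _; have [? ? ?] := st i.
    by case: (leP (t i) b) => ?; case: (leP (s i) b) => ?; lra.
have K2 : \sum_(i < k) `|x (Num.max (t i) b) - x (Num.max (s i) b)| < e / 2.
  apply: (H2 k (fun i => Num.max (s i) b) (fun i => Num.max (t i) b)).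
  - move=> i; have [? ? ?] := st i.
    by rewrite !ge_max !le_max; split; rewrite ?lexx ?orbT//; lra.
  - move=> i j _ _ [y [/=]]; rewrite !in_itv /= !lt_max !gt_max.
    move=> /andP[/andP[si yb] ti] /andP[/andP[sj _] tj].
    apply: tI => //; exists y; split; rewrite /= in_itv /= ?si ?sj /=.
      by case/orP: ti => //; lra.
    by case/orP: tj => //; lra.
  - apply: le_lt_trans L2; apply: ler_sum => i _; have [? ? ?] := st i.
    by case: (leP (t i) b) => ?; case: (leP (s i) b) => ?; lra.
apply: (@le_lt_trans _ _ (\sum_(i < k) `|x (Num.min (t i) b) - x (Num.min (s i) b)|
   + \sum_(i < k) `|x (Num.max (t i) b) - x (Num.max (s i) b)|)); last by lra.
rewrite -big_split /=; apply: ler_sum => i _; have [? ? ?] := st i.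
case: (leP (t i) b) => ?; case: (leP (s i) b) => ?.
- by rewrite subrr normr0 addr0.
- by lra.
- by rewrite addrC -[X in `|X - _|](subrK (x b)) -addrA; exact: ler_normD.
- by rewrite subrr normr0 add0r.
Qed.

Lemma ac_within_continuous a b x : absolutely_continuous a b x ->
  {within `[a, b], continuous x}.
Proof.
move=> acx; apply/subspace_continuousP => c /=; rewrite in_itv /= => cab.
apply/cvgrPdist_lt => e e0; have [d d0 H] := acx e e0.
rewrite near_withinE; apply/nbhs_ballP; exists d => //= y.
rewrite /ball /= in_itv /= => cy yab.
have := H 1%N (fun=> Num.min c y) (fun=> Num.max c y).
rewrite !big_ord1; case: (leP c y) => cy'.
  rewrite distrC; apply.
  - by move=> _; split; lra.
  - by move=> i j _ _ _; rewrite !ord1.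
  - by move: cy; rewrite ler0_norm; lra.
apply.
- by move=> _; split; lra.
- by move=> i j _ _ _; rewrite !ord1.
- by move: cy; rewrite ger0_norm; lra.
Qed.

Lemma derive_nondecreasing (rho drho : R -> R) a b :
  (forall c, is_derive c (1 : R) rho (drho c)) ->
  (forall c, a <= c <= b -> 0 <= drho c) ->
  forall s t, a <= s -> s <= t -> t <= b -> rho s <= rho t.
Proof.
move=> dr dr0 s t as_ st tb.
have cr : {within `[a, b], continuous rho}.
  apply: continuous_subspaceT => c; apply: differentiable_continuous.
  by apply/derivable1_diffP; case: (dr c).
apply: (@ger0_derive1_le_cc _ rho a b _ _ cr) => //.
- move=> c; rewrite in_itv /= => /andP[? ?].
  by rewrite derive1E (@derive_val _ _ _ _ _ _ _ (dr c)) dr0//; lra.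
- by rewrite in_itv /=; lra.
- by rewrite in_itv /=; lra.
Qed.

(** The case [S = {p}] of [ac_mean_value], where the tolerance can be sent to
    0. *)
Lemma ac_increment_le x (rho drho : R -> R) (p : V) a b :
  a <= b -> absolutely_continuous a b x ->
  (forall c, is_derive c (1 : R) rho (drho c)) ->
  (forall c, a <= c <= b -> 0 <= drho c) ->
  {ae lebesgue_measure, forall c : R, c \in `]a, b[ ->
     exists2 l, is_derive c (1 : R) x l & `|l - p| <= drho c} ->
  `|x b - x a - (b - a) *: p| <= rho b - rho a.
Proof.
move=> ab acx dr dr0 aex; apply/ler_addgt0Pr => e e0.
have cS : convex_in [set p].
  by move=> u v l -> -> _ /=; rewrite -scalerDl addrC subrK scale1r.
have [||v -> //] := @ac_mean_value R V x rho drho [set p] a b e ab acx cS _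
  (derive_nondecreasing dr dr0) dr _ e0; first by exists p.
move: aex; apply: filterS; first exact: (ae_filter_ringOfSetsType lebesgue_measure).
move=> c /[swap] cab /(_ cab)[l xl lp].
by exists l, p.
Qed.

End AbsoluteContinuity.

(** * Exponential bounds and Gronwall's inequality *)

Lemma ae_imply (R : realType) (P Q : R -> Prop) : (forall x, P x -> Q x) ->
  {ae (@lebesgue_measure R), forall x, P x} ->
  {ae (@lebesgue_measure R), forall x, Q x}.
Proof.
by move=> PQ; apply: filterS; first exact: (ae_filter_ringOfSetsType lebesgue_measure).
Qed.

Lemma ae_imply2 (R : realType) (P Q S : R -> Prop) :
  (forall x, P x -> Q x -> S x) ->
  {ae (@lebesgue_measure R), forall x, P x} ->
  {ae (@lebesgue_measure R), forall x, Q x} ->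
  {ae (@lebesgue_measure R), forall x, S x}.
Proof.
by move=> PQ; apply: filterS2; first exact: (ae_filter_ringOfSetsType lebesgue_measure).
Qed.

Section Exponentials.
Context {R : realType}.
Implicit Types a b c s x y M : R.

(** All majorants [rho] used with [ac_increment_le] and [ac_mean_value] are of this
    form. *)
Lemma is_derive_exp_quadratic a b c s M x :
  is_derive x (1 : R) (fun y => a * expR ((y - s) * M) + b * y + c * y ^+ 2)
    (a * M * expR ((x - s) * M) + b + 2 * c * x).
Proof.
have H1 : is_derive x (1 : R) (fun y => (y - s) * M) M.
  have H0 : is_derive x (1 : R) (fun y : R => y - s) 1.
    apply: is_derive_eq (is_deriveB (is_derive_id x 1) (is_derive_cst s x 1)) _.
    by rewrite subr0.
  apply: is_derive_eq (is_deriveM H0 (is_derive_cst M x 1)) _.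
  by rewrite /GRing.scale /= mulr0 add0r mulr1.
have H2 := @is_derive1_comp R expR (fun y => (y - s) * M) x _ _
  (is_derive_expR _) H1.
have H3 := is_deriveZ a H2.
have H4 := @is_deriveZ _ _ _ id b x 1 _ (is_derive_id _ _).
have H5 := @is_deriveZ _ _ _ _ c x 1 _ (@is_deriveX _ _ id 2 x 1 1 (is_derive_id _ _)).
apply: is_derive_eq (is_deriveD (is_deriveD H3 H4) H5) _.
by rewrite /GRing.scale /=; ring.
Qed.

Lemma expR_ge_quadratic x : 0 <= x -> 1 + x + x ^+ 2 / 2 <= expR x.
Proof.
move=> x0.
have := @derive_nondecreasing R _ _ 0 x
  (is_derive_exp_quadratic 1 (-1) (- 2^-1) 0 1) _ 0 x (lexx _) x0 (lexx _).
rewrite !subr0 !mul1r !mulr1 expR0 mulr0 expr0n /= mulr0 => /(_ _)/wrap[]; last by lra.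
by move=> c _; have := expR_ge1Dx c; rewrite subr0 mulr1; lra.
Qed.

Lemma rfun_ge_sqr M s : 0 <= M -> 0 <= s -> (s * M) ^+ 2 / 2 <= rfun M s.
Proof.
move=> M0 s0; have := expR_ge_quadratic (mulr_ge0 s0 M0); rewrite /rfun; lra.
Qed.

Lemma rfun_ge0 M s : 0 <= rfun M s.
Proof. by rewrite /rfun; have := expR_ge1Dx (s * M); lra. Qed.

Lemma rfun_le M s t : 0 <= M -> 0 <= s -> s <= t -> rfun M s <= rfun M t.
Proof.
move=> M0 s0 st; rewrite /rfun.
have -> : t * M = s * M + (t - s) * M by ring.
rewrite expRD; have := expR_ge1Dx ((t - s) * M).
have H1 : 1 <= expR (s * M).
  by have := expR_ge1Dx (s * M); have := mulr_ge0 s0 M0; lra.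
have H2 : 0 <= (t - s) * M by rewrite mulr_ge0//; lra.
move=> H3; have : expR (s * M) * (1 + (t - s) * M) <= expR (s * M) * expR ((t - s) * M).
  by rewrite ler_wpM2l//; lra.
have : 1 * ((t - s) * M) <= expR (s * M) * ((t - s) * M) by rewrite ler_wpM2r.
lra.
Qed.

Lemma expR_tangent M s x y :
  expR ((x - s) * M) * ((y - x) * M) <= expR ((y - s) * M) - expR ((x - s) * M).
Proof.
have -> : (y - s) * M = (x - s) * M + (y - x) * M by ring.
rewrite expRD; have := ler_wpM2l (expR_ge0 ((x - s) * M)) (expR_ge1Dx ((y - x) * M)).
lra.
Qed.

Lemma expR_scaled_ge1 M s x : 0 <= M -> s <= x -> 1 <= expR ((x - s) * M).
Proof.
move=> M0 sx; have := expR_ge1Dx ((x - s) * M).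
have : 0 <= (x - s) * M by rewrite mulr_ge0//; lra.
lra.
Qed.

End Exponentials.

(** The largest value [K] of [exp (-M (y - s)) (`|w y| + k / M)] bounds the speed
    up to the point [c] where it is attained by the derivative of [K exp (M (y - s))];
    integrating that bound up to [c] shows that [K] is at most the initial
    value. *)
Lemma gronwall (R : realType) (V : normedModType R) (w : R -> V) (s t M k : R) :
  0 < M -> 0 <= k -> s <= t -> absolutely_continuous s t w ->
  {ae lebesgue_measure, forall c : R, c \in `]s, t[ ->
     exists2 l, is_derive c (1 : R) w l & `|l| <= M * `|w c| + k} ->
  `|w t| + k / M <= (`|w s| + k / M) * expR ((t - s) * M).
Proof.
move=> M0 k0 st acw aew.
pose f y := (`|w y| + k / M) * expR (- ((y - s) * M)).
have cf : {within `[s, t], continuous f}.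
  have cw := ac_within_continuous acw.
  move=> y; apply: cvgM.
    by apply: cvgD; [apply: cvg_norm; exact: cw|exact: cvg_cst].
  apply: (@continuous_subspaceT _ _ _ (fun y : R => expR (- ((y - s) * M)))) => {}y.
  apply: continuous_comp; last exact: continuous_expR.
  apply: cvgN; apply: cvgM; last exact: cvg_cst.
  by apply: cvgB; [exact: cvg_id|exact: cvg_cst].
have [c cst fmax] := EVT_max st cf.
move: cst; rewrite in_itv /= => /andP[sc ct].
pose K := f c.
have K0 : 0 <= K.
  by rewrite /K mulr_ge0 ?expR_ge0// addr_ge0// divr_ge0// ltW.
have wK y : s <= y <= t -> `|w y| + k / M <= K * expR ((y - s) * M).
  move=> yst; rewrite -ler_pdivrMr ?expR_gt0// -expRN; apply: fmax.
  by rewrite in_itv.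
have E : `|w c| + k / M = K * expR ((c - s) * M).
  by rewrite /K /f -mulrA -expRD addNr expR0 mulr1.
have := @ac_increment_le R V w _ _ 0 s c sc (ac_restrict (lexx _) ct acw)
  (is_derive_exp_quadratic K 0 0 s M) _ _.
rewrite scaler0 subr0 subrr !mul0r expR0 !addr0 mulr1 => /(_ _ _)/wrap[].
- move=> y _; rewrite addr0 mulr0 mul0r addr0.
  by rewrite mulr_ge0 ?expR_ge0// mulr_ge0// ltW.
- apply: ae_imply aew => y Hy ysc.
  have [|l wl lw] := Hy; first by move: ysc; rewrite !in_itv /=; lra.
  exists l => //; rewrite subr0 mulr0 mul0r !addr0; apply: le_trans lw _.
  have := wK y; move: ysc; rewrite in_itv /= => ysc /(_ ltac:(lra)).
  move=> /(ler_wpM2l (ltW M0)).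
  have kM : M * (k / M) = k by field; rewrite gt_eqF.
  by rewrite mulrDr kM; lra.
move=> wc; have := ler_normD (w c - w s) (w s); rewrite subrK => N.
apply: le_trans (wK t ltac:(lra)) _; rewrite ler_wpM2r ?expR_ge0//; lra.
Qed.

(** * The transition matrix and the response to a control *)

Record regular_system (R : realType) (n m : nat) (t0 tf : R)
    (A dA : R -> 'M[R]_n) (B dB : R -> 'M[R]_(n, m)) (MA MdA MB MdB : R)
    (phi : R -> R -> 'M[R]_n) : Prop := RegularSystem {
  rs_A_C1 : is_C1_on t0 tf A dA;
  rs_B_C1 : is_C1_on t0 tf B dB;
  rs_MA_gt0 : 0 < MA;
  rs_A_bound : forall t, t \in `[t0, tf] -> opnorm (A t) <= MA;
  rs_dA_bound : forall t, t \in `[t0, tf] -> opnorm (dA t) <= MdA;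
  rs_B_bound : forall t, t \in `[t0, tf] -> opnorm (B t) <= MB;
  rs_dB_bound : forall t, t \in `[t0, tf] -> opnorm (dB t) <= MdB;
  rs_phi : is_transition_matrix A B t0 tf phi
}.

Section LinearSystem.
Context {R : realType} {n m : nat}.
Variables (t0 tf : R) (A dA : R -> 'M[R]_n) (B dB : R -> 'M[R]_(n, m)).
Variables (MA MdA MB MdB : R) (phi : R -> R -> 'M[R]_n).
Hypothesis sys : regular_system t0 tf A dA B dB MA MdA MB MdB phi.

Let MA_gt0 : 0 < MA. Proof. exact: rs_MA_gt0 sys. Qed.

Let MA_ge0 : 0 <= MA. Proof. exact: ltW. Qed.

Lemma norm_A_le t (v : 'cV[R]_n) : t0 <= t <= tf -> `|A t *m v| <= MA * `|v|.
Proof.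
by move=> tt; apply: norm_mulmx_le_trans => //; apply: (rs_A_bound sys); rewrite in_itv.
Qed.

Lemma norm_B_le t (v : 'cV[R]_m) : t0 <= t <= tf -> `|B t *m v| <= MB * `|v|.
Proof.
by move=> tt; apply: norm_mulmx_le_trans => //; apply: (rs_B_bound sys); rewrite in_itv.
Qed.

Lemma A_lipschitz s t (v : 'cV[R]_n) : t0 <= s -> s <= t -> t <= tf ->
  `|(A t - A s) *m v| <= MdA * (t - s) * `|v|.
Proof. exact: (c1_lipschitz (rs_A_C1 sys) (rs_dA_bound sys)). Qed.

Lemma B_lipschitz s t (v : 'cV[R]_m) : t0 <= s -> s <= t -> t <= tf ->
  `|(B t - B s) *m v| <= MdB * (t - s) * `|v|.
Proof. exact: (c1_lipschitz (rs_B_C1 sys) (rs_dB_bound sys)). Qed.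

Lemma MdA_ge0 : t0 <= tf -> 0 <= MdA.
Proof.
move=> tt; apply: le_trans (opnorm_ge0 (dA t0)) _; apply: (rs_dA_bound sys).
by rewrite in_itv /= lexx.
Qed.

Lemma MB_ge0 : t0 <= tf -> 0 <= MB.
Proof.
move=> tt; apply: le_trans (opnorm_ge0 (B t0)) _; apply: (rs_B_bound sys).
by rewrite in_itv /= lexx.
Qed.

Lemma MdB_ge0 : t0 <= tf -> 0 <= MdB.
Proof.
move=> tt; apply: le_trans (opnorm_ge0 (dB t0)) _; apply: (rs_dB_bound sys).
by rewrite in_itv /= lexx.
Qed.

Lemma phi_self s (p : 'cV[R]_n) : t0 <= s <= tf -> phi s s *m p = p.
Proof.
by move=> ss; have [|_ -> _] := rs_phi sys p (s := s); rewrite ?in_itv.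
Qed.

Lemma phi_ac s (p : 'cV[R]_n) a b : t0 <= s <= tf -> t0 <= a -> b <= tf ->
  absolutely_continuous a b (fun t => phi t s *m p).
Proof.
move=> ss ta bt; have [|acp _ _] := rs_phi sys p (s := s).
  by rewrite in_itv.
exact: ac_restrict acp.
Qed.

Lemma phi_derive s (p : 'cV[R]_n) a b : t0 <= s <= tf -> t0 <= a -> b <= tf ->
  {ae lebesgue_measure, forall c : R, c \in `]a, b[ ->
     is_derive c (1 : R) (fun t => phi t s *m p) (A c *m (phi c s *m p))}.
Proof.
move=> ss ta bt; have [|_ _] := rs_phi sys p (s := s).
  by rewrite in_itv.
apply: ae_imply => c Hc cab; rewrite -[X in is_derive _ _ _ X]addr0.
rewrite -[X in _ + X](mulmx0 _ (B c)); apply: Hc.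
by move: cab; rewrite !in_itv /=; lra.
Qed.

Lemma phi_gronwall s t (p : 'cV[R]_n) : t0 <= s -> s <= t -> t <= tf ->
  `|phi t s *m p| <= expR ((t - s) * MA) * `|p|.
Proof.
move=> ts st tt; have ss : t0 <= s <= tf by lra.
have := @gronwall R _ (fun t => phi t s *m p) s t MA 0 MA_gt0 (lexx _) st
  (phi_ac p ss ts tt).
rewrite mul0r !addr0 phi_self// mulrC; apply.
apply: ae_imply (phi_derive p ss ts tt) => c Hc cst.
exists (A c *m (phi c s *m p)); first exact: Hc.
by rewrite addr0 norm_A_le//; move: cst; rewrite in_itv /=; lra.
Qed.

Lemma phi_increment s a b (p : 'cV[R]_n) :
  t0 <= s -> s <= a -> a <= b -> b <= tf ->
  `|phi b s *m p - phi a s *m p| <=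
    (expR ((b - s) * MA) - expR ((a - s) * MA)) * `|p|.
Proof.
move=> ts sa ab bt; have ss : t0 <= s <= tf by lra.
have acp := phi_ac p ss (le_trans ts sa) bt.
have := ac_increment_le (p := 0) ab acp (is_derive_exp_quadratic `|p| 0 0 s MA).
rewrite scaler0 subr0.
have -> : `|p| * expR ((b - s) * MA) + 0 * b + 0 * b ^+ 2 -
   (`|p| * expR ((a - s) * MA) + 0 * a + 0 * a ^+ 2) =
  (expR ((b - s) * MA) - expR ((a - s) * MA)) * `|p| by ring.
apply.
  move=> c _.
  rewrite mulr0 mul0r !addr0.
  by rewrite mulr_ge0 ?expR_ge0// mulr_ge0.
have ta : t0 <= a by lra.
apply: ae_imply (phi_derive p ss ta bt) => c Hc cst.
exists (A c *m (phi c s *m p)); first exact: Hc.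
move: cst; rewrite in_itv /= => cst.
rewrite subr0 mulr0 mul0r !addr0.
apply: le_trans (norm_A_le _ _) _; first by lra.
rewrite mulrAC mulrC (mulrC `|p|) ler_wpM2r//.
by apply: phi_gronwall; lra.
Qed.

(** The velocity changes through [A], at rate [MdA], and through the state, at
    rate [MA ^+ 2]; the convexity bound [expR_tangent] merges the first into a multiple
    of the increment of the exponential. *)
Lemma phi_velocity_increment s x y (p : 'cV[R]_n) :
  t0 <= s -> s <= x -> x <= y -> y <= tf ->
  `|A y *m (phi y s *m p) - A x *m (phi x s *m p)| <=
    (MdA / MA + MA) * `|p| * (expR ((y - s) * MA) - expR ((x - s) * MA)).
Proof.
move=> ts sx xy yt.
have dA0 : 0 <= MdA by apply: MdA_ge0; lra.
have -> : A y *m (phi y s *m p) - A x *m (phi x s *m p) =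
    (A y - A x) *m (phi x s *m p) + A y *m (phi y s *m p - phi x s *m p).
  by rewrite mulmxBl mulmxBr [RHS]addrC addrA subrK.
apply: le_trans (ler_normD _ _) _.
have N1 : `|(A y - A x) *m (phi x s *m p)| <=
    MdA * (y - x) * (expR ((x - s) * MA) * `|p|).
  apply: le_trans (A_lipschitz _ _ _ _) _; [lra|lra|lra|].
  rewrite ler_wpM2l ?mulr_ge0//; first by lra.
  by apply: phi_gronwall; lra.
have N2 : `|A y *m (phi y s *m p - phi x s *m p)| <=
    MA * ((expR ((y - s) * MA) - expR ((x - s) * MA)) * `|p|).
  apply: le_trans (norm_A_le _ _) _; first by lra.
  by rewrite ler_wpM2l//; apply: phi_increment; lra.
have := ler_wpM2l (mulr_ge0 (divr_ge0 dA0 MA_ge0) (normr_ge0 p))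
  (expR_tangent MA s x y).
have -> : MdA / MA * `|p| * (expR ((x - s) * MA) * ((y - x) * MA)) =
    MdA * (y - x) * (expR ((x - s) * MA) * `|p|) by field; rewrite gt_eqF.
lra.
Qed.

(** The right-hand side is the error of the tangent to [exp (MA (x - s))] at
    [c], scaled so that its derivative bounds the change of velocity. *)
Lemma phi_tangent s c x (p : 'cV[R]_n) :
  t0 <= s -> s <= c <= tf -> s <= x <= tf ->
  `|phi x s *m p - phi c s *m p - (x - c) *: (A c *m (phi c s *m p))| <=
    (MdA / MA + MA) * `|p| / MA *
    (expR ((x - s) * MA) - expR ((c - s) * MA)
       - (x - c) * (expR ((c - s) * MA) * MA)).
Proof.
move=> ts /andP[sc ct] /andP[sx xt]; have ss : t0 <= s <= tf by lra.
have dA0 : 0 <= MdA by apply: MdA_ge0; lra.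
pose E y := expR ((y - s) * MA); rewrite -/(E x) -/(E c).
pose K := (MdA / MA + MA) * `|p|; rewrite -/K.
have K0 : 0 <= K by rewrite mulr_ge0// addr_ge0// divr_ge0.
have KM y z : - K / MA * MA * E y + K * E z = K * (E z - E y).
  by field; rewrite gt_eqF.
have KM' y z : K / MA * MA * E y + - K * E z = K * (E y - E z).
  by field; rewrite gt_eqF.
have E_le y z : y <= z -> 0 <= E z - E y.
  move=> yz; rewrite subr_ge0 ler_expR ler_wpM2r//; lra.
have [xc|cx] := leP x c.
  have tx : t0 <= x by lra.
  have := @ac_increment_le R _ (fun y => phi y s *m p) _ _
    (A c *m (phi c s *m p)) x c xc (phi_ac p ss tx ct)
    (is_derive_exp_quadratic (- K / MA) (K * E c) 0 s MA).
  rewrite -/(E x) -/(E c) => /(_ _ _)/wrap[].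
  - move=> y xyc; rewrite mulr0 mul0r addr0 -/(E y) KM.
    by rewrite mulr_ge0// E_le//; lra.
  - apply: ae_imply (phi_derive p ss tx ct) => y Hy xyc.
    exists (A y *m (phi y s *m p)); first exact: Hy.
    move: xyc; rewrite in_itv /= => xyc.
    rewrite mulr0 mul0r addr0 -/(E y) KM distrC.
    by apply: phi_velocity_increment; lra.
  move=> H; rewrite -normrN.
  have -> : - (phi x s *m p - phi c s *m p - (x - c) *: (A c *m (phi c s *m p))) =
      phi c s *m p - phi x s *m p - (c - x) *: (A c *m (phi c s *m p)).
    by rewrite !opprB scalerBl (scalerBl c) opprB addrC addrCA addrC.
  apply: le_trans H _; rewrite le_eqVlt; apply/orP; left; apply/eqP.
  by field; rewrite gt_eqF.
have tc : t0 <= c by lra.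
have := @ac_increment_le R _ (fun y => phi y s *m p) _ _
  (A c *m (phi c s *m p)) c x (ltW cx) (phi_ac p ss tc xt)
  (is_derive_exp_quadratic (K / MA) (- K * E c) 0 s MA).
rewrite -/(E x) -/(E c) => /(_ _ _)/wrap[].
- move=> y cyx; rewrite mulr0 mul0r addr0 -/(E y) KM'.
  by rewrite mulr_ge0// E_le//; lra.
- apply: ae_imply (phi_derive p ss tc xt) => y Hy cyx.
  exists (A y *m (phi y s *m p)); first exact: Hy.
  move: cyx; rewrite in_itv /= => cyx.
  rewrite mulr0 mul0r addr0 -/(E y) KM'.
  by apply: phi_velocity_increment; lra.
move=> H; apply: le_trans H _; rewrite le_eqVlt; apply/orP; left; apply/eqP.
by field; rewrite gt_eqF.
Qed.

(** Both increments of [f t = phi t s *m p] around the intermediate time [t] are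
    compared with the same velocity [A t *m f t]; in the convex combination that
    measures the interpolation error this velocity cancels. What remains is the
    interpolation error of [exp (MA (t - s))], which is at most [rfun]. *)
Lemma phi_interpolation s t e l (p : 'cV[R]_n) :
  t0 <= s -> s <= e -> e <= tf -> 0 <= l <= 1 -> t - s = l * (e - s) ->
  `|phi t s *m p - ((1 - l) *: p + l *: (phi e s *m p))| <=
    gamma MA MdA (e - s) * `|p|.
Proof.
move=> ts se et /andP[l0 l1] tl; have ss : t0 <= s <= tf by lra.
have es0 : 0 <= e - s by lra.
have st : s <= t by have := mulr_ge0 l0 es0; lra.
have te : t <= e by have := ler_wpM2r es0 l1; lra.
have dA0 : 0 <= MdA by apply: MdA_ge0; lra.
pose E x := expR ((x - s) * MA).
pose f x := phi x s *m p.
have fs : f s = p by exact: phi_self.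
pose P := A t *m f t.
pose K := (MdA / MA + MA) * `|p|.
have K0 : 0 <= K by rewrite mulr_ge0// addr_ge0// divr_ge0.
have left := @phi_tangent s t s p ts ltac:(lra) ltac:(lra).
have right := @phi_tangent s t e p ts ltac:(lra) ltac:(lra).
rewrite -/(f t) -/(f e) -/(f s) -/P -/(E t) -/(E e) -/(E s) -/K in left right.
have -> : phi t s *m p - ((1 - l) *: p + l *: (phi e s *m p)) =
    - ((1 - l) *: (f s - f t - (s - t) *: P) + l *: (f e - f t - (e - t) *: P)).
  have -> : s - t = - (l * (e - s)) by lra.
  have -> : e - t = (1 - l) * (e - s) by lra.
  by rewrite fs -/(f t) -/(f e); apply/matrixP => i j; rewrite !mxE; ring.
rewrite normrN; apply: le_trans (ler_normD _ _) _.
rewrite !normrZ !ger0_norm ?subr_ge0//.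
have N1 := ler_wpM2l (ltac:(lra) : 0 <= 1 - l) left.
have N2 := ler_wpM2l l0 right.
apply: le_trans (lerD N1 N2) _.
have Es : E s = 1 by rewrite /E subrr mul0r expR0.
have Et := expR_tangent MA s s t; rewrite -/(E t) -/(E s) Es mul1r in Et.
have -> : (1 - l) * (K / MA * (E s - E t - (s - t) * (E t * MA)))
    + l * (K / MA * (E e - E t - (e - t) * (E t * MA))) =
    K / MA * (l * (E e - 1) - (E t - 1)).
  have -> : s - t = - (l * (e - s)) by lra.
  have -> : e - t = (1 - l) * (e - s) by lra.
  by rewrite Es; ring.
have -> : gamma MA MdA (e - s) * `|p| = K / MA * rfun MA (e - s).
  by rewrite /gamma /K; field; rewrite gt_eqF.
rewrite ler_wpM2l ?divr_ge0// -/(E e).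
have := ler_piMl (rfun_ge0 MA (e - s)) l1; rewrite {1}/rfun -/(E e).
rewrite tl in Et; lra.
Qed.

Section Response.
Variables (q : nat) (c0 : 'cV[R]_m) (G : 'M[R]_(m, q)).
Local Notation U := (zonotope c0 G).
Local Notation nU := (setnorm U).

(** With [w t = x t - phi t s *m x s], Gronwall bounds [w], hence bounds the
    distance of [w' = A w + B u] to [B te u] by an explicit function of time; the
    mean of the velocities [B te u] lies in [B te U] as [U] is convex and
    compact. *)
Lemma control_response (x : R -> 'cV[R]_n) (u : R -> 'cV[R]_m) s t te :
  t0 <= s -> s <= t -> t <= te -> te <= tf ->
  absolutely_continuous s t x ->
  {ae lebesgue_measure, forall c : R, c \in `]s, t[ ->
     is_derive c (1 : R) x (A c *m x c + B c *m u c)} ->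
  (forall c, s <= c <= t -> U (u c)) ->
  exists2 v, U v & `|x t - phi t s *m x s - (t - s) *: (B te *m v)| <=
    alpha nU MA MB MdB (te - s).
Proof.
move=> ts st tte tef acx aex uU.
have ss : t0 <= s <= tf by lra.
have ttf : t <= tf by lra.
have tt : t0 <= tf by lra.
have nU0 : 0 <= nU := setnorm_zonotope_ge0 c0 G.
have MB0 := MB_ge0 tt; have MdB0 := MdB_ge0 tt.
pose k := MB * nU.
have k0 : 0 <= k by rewrite mulr_ge0.
pose w y := x y - phi y s *m x s.
have acw : absolutely_continuous s t w.
  by apply: ac_sub => //; apply: phi_ac.
have ws : w s = 0 by rewrite /w phi_self ?subrr.
have aew : {ae lebesgue_measure, forall c : R, c \in `]s, t[ ->
     is_derive c (1 : R) w (A c *m w c + B c *m u c)}.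
  apply: ae_imply2 aex (phi_derive (x s) ss ts ttf) => c Hx Hp cst.
  apply: is_derive_eq (is_deriveB (Hx cst) (Hp cst)) _.
  by rewrite /w mulmxBr addrAC.
pose E y := expR ((y - s) * MA).
have wE y : s <= y <= t -> `|w y| <= k / MA * (E y - 1).
  move=> /andP[sy yt].
  have := @gronwall R _ w s y MA k MA_gt0 k0 sy (ac_restrict (lexx _) yt acw).
  rewrite ws normr0 add0r -/(E y) => /(_ _)/wrap[]; last by lra.
  apply: ae_imply aew => c Hc csy; exists (A c *m w c + B c *m u c).
    by apply: Hc; move: csy; rewrite !in_itv /=; lra.
  move: csy; rewrite in_itv /= => csy.
  apply: le_trans (ler_normD _ _) _; apply: lerD; first by apply: norm_A_le; lra.
  apply: le_trans (norm_B_le _ _) _; first by lra.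
  by rewrite ler_wpM2l// zonotope_setnorm//; apply: uU; lra.
pose S := [set B te *m v | v in U].
have cS : convex_in S.
  move=> _ _ l [v Uv <-] [v' Uv' <-] l01.
  exists (l *: v + (1 - l) *: v'); first exact: convex_zonotope.
  by rewrite mulmxDr -!scalemxAr.
have S0 : S !=set0.
  by exists (B te *m c0), c0 => //; exact: zonotope_nonempty.
(* The derivative of [rho] is the sum of the bounds for [A w] and for
   [(B c - B te) u]. *)
pose rho := fun y => k / MA * expR ((y - s) * MA)
   + (MdB * nU * te - k) * y + (- (MdB * nU / 2)) * y ^+ 2.
have drho := is_derive_exp_quadratic (k / MA) (MdB * nU * te - k)
  (- (MdB * nU / 2)) s MA.
have drhoE c : k / MA * MA * expR ((c - s) * MA) + (MdB * nU * te - k)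
    + 2 * (- (MdB * nU / 2)) * c = k * (E c - 1) + MdB * nU * (te - c).
  by rewrite /E; field; rewrite gt_eqF.
have drho0 c : s <= c <= t -> 0 <= k * (E c - 1) + MdB * nU * (te - c).
  move=> cst; have := @expR_scaled_ge1 _ MA s c MA_ge0 ltac:(lra).
  rewrite -/(E c) => E1.
  by rewrite addr_ge0// mulr_ge0 ?mulr_ge0//; lra.
have rhoM := @derive_nondecreasing R _ _ s t drho _.
have rho_alpha : rho t - rho s <= alpha nU MA MB MdB (te - s).
  have r1 := rfun_le MA_ge0 (ltac:(lra) : 0 <= t - s) (ltac:(lra) : t - s <= te - s).
  have r2 := rfun_ge_sqr MA_ge0 (ltac:(lra) : 0 <= te - s).
  have -> : rho t - rho s = k / MA * rfun MA (t - s)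
      + MdB * nU / MA ^+ 2 * (((te - s) * MA) ^+ 2 / 2
          - ((te - t) * MA) ^+ 2 / 2).
    by rewrite /rho /rfun subrr mul0r expR0; field; rewrite gt_eqF.
  have -> : alpha nU MA MB MdB (te - s) = k / MA * rfun MA (te - s)
      + MdB * nU / MA ^+ 2 * rfun MA (te - s).
    by rewrite /alpha /k; field; rewrite gt_eqF.
  apply: lerD; rewrite ler_wpM2l// ?divr_ge0 ?mulr_ge0 ?exprn_ge0//.
  by have := sqr_ge0 ((te - t) * MA); lra.
have [|v Uv vx] := @zonotope_attains _ _ _ _ c0 G ((t - s) *: B te)
  (x t - phi t s *m x s) (alpha nU MA MB MdB (te - s)); last first.
  by exists v => //; rewrite scalemxAl.
move=> e e0.
have [||_ [v Uv <-] vx] := @ac_mean_value R _ w rho _ S s t e st acw cS S0 _ drho _ e0.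
- by apply: rhoM => c cst; rewrite drhoE drho0.
- apply: ae_imply aew => c Hc cst.
  exists (A c *m w c + B c *m u c), (B te *m u c).
  move: (Hc cst) => Hcst; move: cst; rewrite in_itv /= => cst.
  split => //; first by exists (u c) => //; apply: uU; lra.
  have Uc : `|u c| <= nU by apply: zonotope_setnorm; apply: uU; lra.
  rewrite drhoE -addrA -mulmxBl.
  apply: le_trans (ler_normD _ _) _; apply: lerD.
    apply: le_trans (norm_A_le _ _) _; first by lra.
    have := ler_wpM2l MA_ge0 (wE c ltac:(lra)).
    by have -> : MA * (k / MA * (E c - 1)) = k * (E c - 1) by field; rewrite gt_eqF.
  rewrite -opprB mulNmx normrN.
  apply: le_trans (B_lipschitz _ _ _ _) _; [lra|lra|lra|].
  have -> : MdB * nU * (te - c) = MdB * (te - c) * nU by ring.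
  by rewrite ler_wpM2l// mulr_ge0//; lra.
exists v => //; rewrite -scalemxAl.
move: vx; rewrite ws subr0 => vx.
by apply: le_trans vx _; rewrite lerD2r.
Qed.

End Response.
End LinearSystem.

(** * Derivatives of matrix products and primitives *)

Section Derivatives.
Context {R : realType}.

Lemma is_derive_mxP (k l : nat) (M : R -> 'M[R]_(k, l)) (D : 'M[R]_(k, l)) t :
  is_derive t (1 : R) M D <->
  forall i j, is_derive t (1 : R) (fun x => M x i j) (D i j).
Proof.
split=> [[dM <-] i j|dM].
  have dMij := (derivable_mxP M t 1).1 dM.
  by split; [exact: dMij|rewrite derive_mx// mxE].
have dM' : derivable M t 1 by apply/derivable_mxP => i j; case: (dM i j).
split => //; rewrite derive_mx//; apply/matrixP => i j; rewrite mxE.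
by case: (dM i j).
Qed.

Lemma is_derive_mulmx (k l : nat) (Y : R -> 'M[R]_(k, l)) (W : R -> 'cV[R]_l)
    (dY : 'M[R]_(k, l)) (dW : 'cV[R]_l) t :
  is_derive t (1 : R) Y dY -> is_derive t (1 : R) W dW ->
  is_derive t (1 : R) (fun x => Y x *m W x) (dY *m W t + Y t *m dW).
Proof.
move=> /is_derive_mxP dYt /is_derive_mxP dWt; apply/is_derive_mxP => i j.
have -> : (fun x => (Y x *m W x) i j) =
    \sum_(r < l) ((fun x => Y x i r) * (fun x => W x r j)).
  by apply/funext => x; rewrite mxE fct_sumE.
apply: is_derive_eq (is_derive_sum (fun r => is_deriveM (dYt i r) (dWt r j))) _.
rewrite !mxE -big_split /=; apply: eq_bigr => r _.
by rewrite /GRing.scale /=; ring.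
Qed.

Lemma continuous_primitive (h : R -> R) (s : R) : continuous h ->
  exists F : R -> R, F s = 0 /\
    forall c, s - 1 < c -> is_derive c (1 : R) F (h c).
Proof.
move=> ch; pose F0 x := (\int[lebesgue_measure]_(t in `[s - 1, x]) h t)%R.
have dF c : s - 1 < c -> is_derive c (1 : R) F0 (h c).
  move=> sc; have := @continuous_FTC1_closed R h (s - 1) c (c + 1).
  have ci : lebesgue_measure.-integrable `[s - 1, c + 1] (EFin \o h).
    apply: continuous_compact_integrable; first exact: segment_compact.
    exact: continuous_subspaceT.
  move=> /(_ ltac:(lra) ci sc (ch c))[dFc Fc].
  by split; [exact: dFc|rewrite -derive1E].
exists (fun x => F0 x - F0 s); split; first by rewrite subrr.
move=> c sc; apply: is_derive_eq (is_deriveB (dF c sc) (is_derive_cst (F0 s) c 1)) _.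
by rewrite subr0.
Qed.

(** Freezing [g] outside [`[s, e]] makes it continuous on the whole line, so that
    the integral has a two-sided derivative up to the end points. *)
Lemma lipschitz_primitive (k : nat) (g : R -> 'cV[R]_k) (s e L C : R) :
  s <= e -> 0 <= L ->
  (forall x y, s <= x -> x <= y -> y <= e -> `|g y - g x| <= L * (y - x)) ->
  (forall x, s <= x <= e -> `|g x| <= C) ->
  exists W : R -> 'cV[R]_k, [/\ W s = 0,
    forall c, s < c < e -> is_derive c (1 : R) W (g c) &
    forall x y, s <= x -> x <= y -> y <= e -> `|W y - W x| <= C * (y - x)].
Proof.
move=> se L0 gL gC.
pose clamp x := Num.max s (Num.min x e).
have clampI x : s <= clamp x <= e.
  by rewrite /clamp; case: (leP x e) => ?; [case: (leP s x)|case: (leP s e)] => ?; lra.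
have clamp_id x : s <= x <= e -> clamp x = x.
  by move=> ?; rewrite /clamp min_l ?max_r; lra.
have clampL x y : x <= y -> 0 <= clamp y - clamp x <= y - x.
  move=> xy; rewrite /clamp.
  case: (leP x e) => ?; case: (leP y e) => ?; case: (leP s x) => ?;
    case: (leP s y) => ?; case: (leP s e) => ?; lra.
have gcl x y : `|g (clamp x) - g (clamp y)| <= L * `|x - y|.
  wlog xy : x y / x <= y.
    move=> H; have [/H //|/ltW/H] := leP x y.
    by rewrite distrC (distrC y).
  have [] := andP (clampI x); have [] := andP (clampI y).
  have [? ?] := andP (clampL _ _ xy); move=> ? ? ? ?.
  rewrite distrC; apply: le_trans (gL (clamp x) (clamp y) ltac:(lra) ltac:(lra) ltac:(lra)) _.
  by rewrite distrC ger0_norm ?subr_ge0// ler_wpM2l.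
have ch i : continuous (fun x => g (clamp x) i 0).
  move=> x; apply/cvgrPdist_le => /= r r0.
  apply/nbhs_ballP; exists (r / (L + 1)); first by rewrite /= divr_gt0//; lra.
  move=> y; rewrite /ball /= ltr_pdivlMr; last by lra.
  move=> xy; have := le_trans (cV_entry_le (g (clamp x) - g (clamp y)) i) (gcl x y).
  by rewrite !mxE => H; apply: le_trans H _; have := normr_ge0 (x - y); lra.
pose F i := sval (cid (continuous_primitive s (ch i))).
have Fs i : F i s = 0 by rewrite /F; case: cid => f [].
have dF i c : s - 1 < c -> is_derive c (1 : R) (F i) (g (clamp c) i 0).
  by rewrite /F; case: cid => f [] _ /=; apply.
exists (fun x => \col_i F i x); split.
- by apply/matrixP => i j; rewrite !mxE.
- move=> c sce; apply/is_derive_mxP => i j; rewrite (ord1 j).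
  have -> : (fun x => (\col_i0 F i0 x) i 0) = F i by apply/funext => x; rewrite mxE.
  rewrite -[in X in is_derive _ _ _ X](clamp_id c); last by lra.
  by apply: dF; lra.
- move=> x y sx xy ye; have C0 : 0 <= C := le_trans (normr_ge0 _) (gC s ltac:(lra)).
  apply: cV_norm_le => [|i]; first by rewrite mulr_ge0//; lra.
  rewrite !mxE; have [->|xny] := eqVneq x y; first by rewrite !subrr normr0 mulr0.
  have [|||c cxy ->] := @MVT R (F i) (fun c => g (clamp c) i 0) x y.
  - by rewrite lt_neqAle xny.
  - by move=> c; rewrite in_itv /= => ?; apply: dF; lra.
  - apply: derivable_within_continuous => c; rewrite in_itv /= => ?.
    by have [] := dF i c ltac:(lra).
  rewrite normrM (ger0_norm (_ : 0 <= y - x)) ?subr_ge0//.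
  rewrite ler_wpM2r ?subr_ge0//.
  by apply: le_trans (cV_entry_le _ i) _; exact: gC.
Qed.

End Derivatives.

(** * Solutions for constant controls *)

Section Existence.
Context {R : realType} {n m : nat}.
Variables (t0 tf : R) (A dA : R -> 'M[R]_n) (B dB : R -> 'M[R]_(n, m)).
Variables (MA MdA MB MdB : R) (phi : R -> R -> 'M[R]_n).
Hypothesis sys : regular_system t0 tf A dA B dB MA MdA MB MdB phi.

Let MA_gt0 : 0 < MA. Proof. exact: rs_MA_gt0 sys. Qed.

Let MA_ge0 : 0 <= MA. Proof. exact: ltW. Qed.

(** The error in [phi_tangent] is [o(x - c)], as it is the tangent error of a
    differentiable function: the derivative exists at every time, not only
    almost everywhere. *)
Lemma phi_is_derive s c : t0 <= s -> s < c -> c < tf ->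
  is_derive c (1 : R) (fun x => phi x s) (A c *m phi c s).
Proof.
move=> ts sc ct.
have dphi (p : 'cV[R]_n) :
    is_derive c (1 : R) (fun x => phi x s *m p) (A c *m phi c s *m p).
  apply/is_derive_approx => e e0.
  have dA0 : 0 <= MdA by apply: (MdA_ge0 sys); lra.
  pose K := (MdA / MA + MA) * `|p| / MA.
  have K0 : 0 <= K by rewrite divr_ge0// mulr_ge0// addr_ge0// divr_ge0.
  have [d d0 Hd] := (is_derive_approx _ _ _).1
    (is_derive_exp_quadratic 1 0 0 s MA c) (e / (K + 1)) ltac:(by rewrite divr_gt0//; lra).
  exists (Num.min d (Num.min (c - s) (tf - c))).
    by rewrite !lt_min d0; lra.
  move=> x; rewrite !lt_min => /andP[xd /andP[xs xt]].
  have := phi_tangent sys p ts (c := c) (x := x) ltac:(lra).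
  have sxt : s <= x <= tf by move: xs xt; rewrite !ltr_norml; lra.
  move=> /(_ sxt); rewrite -mulmxA => H; apply: le_trans H _.
  have := Hd x xd; rewrite /GRing.scale /=.
  have -> : 1 * expR ((x - s) * MA) + 0 * x + 0 * x ^+ 2 -
     (1 * expR ((c - s) * MA) + 0 * c + 0 * c ^+ 2) -
     (x - c) * (1 * MA * expR ((c - s) * MA) + 0 + 2 * 0 * c) =
     expR ((x - s) * MA) - expR ((c - s) * MA)
       - (x - c) * (expR ((c - s) * MA) * MA) by ring.
  rewrite -/K => H; apply: (@le_trans _ _ (K * (e / (K + 1) * `|x - c|))).
    by rewrite ler_wpM2l// (le_trans (ler_norm _) H).
  rewrite mulrA ler_wpM2r// mulrA ler_pdivrMr; last by lra.
  lra.
apply/is_derive_mxP => i j.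
have := (is_derive_mxP _ _ _).1 (dphi (delta_mx j 0)) i 0.
by rewrite -colE mxE; under eq_fun do rewrite -colE mxE.
Qed.

(** As functions of the first argument, [phi x s *m (phi s t *m p)] and
    [phi x t *m p] solve the same equation and agree at [s], hence also at [t]. *)
Lemma phi_cancel s t (p : 'cV[R]_n) : t0 <= s -> s <= t -> t <= tf ->
  phi t s *m (phi s t *m p) = p.
Proof.
move=> ts st tt; have ss : t0 <= s <= tf by lra.
have tt' : t0 <= t <= tf by lra.
pose w x := phi x s *m (phi s t *m p) - phi x t *m p.
have acw : absolutely_continuous s t w.
  by apply: ac_sub; apply: (phi_ac sys).
have := @gronwall R _ w s t MA 0 MA_gt0 (lexx _) st acw.
have -> : w s = 0 by rewrite /w (phi_self sys) ?subrr.
rewrite normr0 mul0r !addr0 mul0r => /(_ _)/wrap[].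
  apply: ae_imply2 (phi_derive sys (phi s t *m p) ss ts tt)
    (phi_derive sys p tt' ts tt) => c H1 H2 cst.
  have := is_deriveB (H1 cst) (H2 cst); rewrite -mulmxBr => Hw.
  exists (A c *m w c); first exact: Hw.
  rewrite addr0 (norm_A_le sys)//; move: cst; rewrite in_itv /=; lra.
by rewrite normr_le0 /w (phi_self sys)// subr_eq0 => /eqP.
Qed.

Section ConstantControl.
Variables (s e : R) (v : 'cV[R]_m).
Hypotheses (ts : t0 <= s) (se : s <= e) (et : e <= tf).
(* The step is so short that [phi x s] stays within distance 1/2 of the
   identity. *)
Hypothesis small : expR ((e - s) * MA) <= 3 / 2.

Let bounds : [/\ t0 <= s, s <= e & e <= tf]. Proof. by []. Qed.

Let exp_small x : s <= x <= e -> expR ((x - s) * MA) <= 3 / 2.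
Proof.
have [ts' se' et'] := bounds; have MA0 := MA_ge0.
move=> xse; apply: le_trans small; rewrite ler_expR ler_wpM2r//; lra.
Qed.

Lemma phi_bounded_below x (p : 'cV[R]_n) : s <= x <= e ->
  `|p| <= 2 * `|phi x s *m p|.
Proof.
have [ts' se' et'] := bounds; have MA0 := MA_ge0.
move=> /andP[sx xe]; have := phi_increment sys p ts (lexx s) sx (le_trans xe et).
rewrite subrr mul0r expR0 (phi_self sys); last by lra.
have := ler_wpM2r (normr_ge0 p) (exp_small (ltac:(lra) : s <= x <= e)).
have := ler_normB (phi x s *m p) (phi x s *m p - p).
rewrite opprB addrC subrK; lra.
Qed.

Lemma phi_short_bound x (p : 'cV[R]_n) : s <= x <= e ->
  `|phi x s *m p| <= 3 / 2 * `|p|.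
Proof.
have [ts' se' et'] := bounds; have MA0 := MA_ge0.
move=> xse; apply: le_trans (phi_gronwall sys p ts _ _) _; [lra|lra|].
by rewrite ler_wpM2r// exp_small.
Qed.

Lemma phi_short_lipschitz x y (p : 'cV[R]_n) : s <= x -> x <= y -> y <= e ->
  `|phi y s *m p - phi x s *m p| <= 3 / 2 * MA * (y - x) * `|p|.
Proof.
have [ts' se' et'] := bounds; have MA0 := MA_ge0.
move=> sx xy ye; apply: le_trans (phi_increment sys p ts sx xy (le_trans ye et)) _.
rewrite ler_wpM2r//.
have := expR_tangent MA s y x.
have := ler_wpM2r (mulr_ge0 (ltac:(lra) : 0 <= y - x) MA_ge0)
  (exp_small (ltac:(lra) : s <= y <= e)).
lra.
Qed.

Lemma phi_inverse_bound x (p : 'cV[R]_n) : s <= x <= e ->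
  `|phi s x *m p| <= 2 * `|p|.
Proof.
have [ts' se' et'] := bounds; have MA0 := MA_ge0.
move=> xse; have := phi_bounded_below (phi s x *m p) xse.
by rewrite phi_cancel//; lra.
Qed.

(** Multiplication by [phi x s] transfers the difference of the inverses to a
    difference of values of [phi] in its first argument. *)
Lemma phi_inverse_lipschitz x y (p : 'cV[R]_n) : s <= x -> x <= y -> y <= e ->
  `|phi s y *m p - phi s x *m p| <= 6 * MA * (y - x) * `|p|.
Proof.
have [ts' se' et'] := bounds; have MA0 := MA_ge0.
move=> sx xy ye; have xse : s <= x <= e by lra.
apply: le_trans (phi_bounded_below _ xse) _.
have -> : phi x s *m (phi s y *m p - phi s x *m p) =
    - (phi y s *m (phi s y *m p) - phi x s *m (phi s y *m p)).
  have xt : x <= tf by lra.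
  by rewrite mulmxBr (phi_cancel p ts sx xt)
    (phi_cancel p ts (le_trans sx xy) (le_trans ye et)) opprB.
rewrite normrN.
have := phi_short_lipschitz (phi s y *m p) sx xy ye.
have := ler_wpM2l (mulr_ge0 (ltac:(lra) : 0 <= 3 / 2 * MA) (ltac:(lra) : 0 <= y - x))
  (phi_inverse_bound p (ltac:(lra) : s <= y <= e)).
lra.
Qed.

(** Variation of constants: [phi x s *m (p + W x)] with [W] a primitive of
    [phi s x *m B x *m v]. *)
Lemma constant_control_solution (p : 'cV[R]_n) :
  exists z : R -> 'cV[R]_n, [/\ absolutely_continuous s e z, z s = p &
    forall c, s < c < e -> is_derive c (1 : R) z (A c *m z c + B c *m v)].
Proof.
have [ts' se' et'] := bounds; have MA0 := MA_ge0.
have tt : t0 <= tf by lra.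
have MB0 := MB_ge0 sys tt; have MdB0 := MdB_ge0 sys tt.
pose g x := phi s x *m (B x *m v).
have gC x : s <= x <= e -> `|g x| <= 2 * (MB * `|v|).
  move=> xse; apply: le_trans (phi_inverse_bound _ xse) _.
  by rewrite ler_wpM2l// (norm_B_le sys)//; lra.
pose L := 2 * MdB * `|v| + 6 * MA * (MB * `|v|).
have L0 : 0 <= L by rewrite addr_ge0// !mulr_ge0.
have gL x y : s <= x -> x <= y -> y <= e -> `|g y - g x| <= L * (y - x).
  move=> sx xy ye.
  have -> : g y - g x = phi s y *m ((B y - B x) *m v)
      + (phi s y *m (B x *m v) - phi s x *m (B x *m v)).
    by rewrite /g mulmxBl mulmxBr addrA subrK.
  apply: le_trans (ler_normD _ _) _.
  have yse : s <= y <= e by lra.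
  have := phi_inverse_bound ((B y - B x) *m v) yse.
  have := B_lipschitz sys v (s := x) (t := y) ltac:(lra) xy ltac:(lra).
  have := phi_inverse_lipschitz (B x *m v) sx xy ye.
  have := ler_wpM2l (mulr_ge0 (ltac:(lra) : 0 <= 6 * MA) (ltac:(lra) : 0 <= y - x))
    (norm_B_le sys v (ltac:(lra) : t0 <= x <= tf)).
  rewrite /L; lra.
have [W [Ws dW WL]] := lipschitz_primitive se L0 gL gC.
pose C := 2 * (MB * `|v|).
have C0 : 0 <= C by rewrite mulr_ge0 ?mulr_ge0.
have WC x : s <= x <= e -> `|W x| <= C * (e - s).
  move=> xse; have := WL s x (lexx _) ltac:(lra) ltac:(lra).
  rewrite Ws subr0 -/C => H; apply: le_trans H _.
  by rewrite ler_wpM2l//; lra.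
exists (fun x => phi x s *m (p + W x)); split.
- pose D := `|p| + C * (e - s).
  have D0 : 0 <= D by rewrite addr_ge0// mulr_ge0//; lra.
  apply: (@ac_lipschitz _ _ _ _ _ (3 / 2 * MA * D + 3 / 2 * C)).
    by rewrite addr_ge0 ?mulr_ge0//; lra.
  move=> x y sx xy ye.
  have -> : phi y s *m (p + W y) - phi x s *m (p + W x) =
      (phi y s *m (p + W y) - phi x s *m (p + W y)) + phi x s *m (W y - W x).
    have -> : W y - W x = (p + W y) - (p + W x).
      by rewrite opprD addrACA subrr add0r.
    by rewrite mulmxBr addrA subrK.
  have pW : `|p + W y| <= D.
    by apply: le_trans (ler_normD _ _) _; rewrite lerD2l WC//; lra.
  have yx0 : 0 <= y - x by lra.
  have N1 := le_trans (phi_short_lipschitz (p + W y) sx xy ye)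
    (ler_wpM2l (mulr_ge0 (mulr_ge0 (ltac:(lra) : 0 <= 3 / 2 :> R) MA0) yx0) pW).
  have N2 := le_trans (phi_short_bound (W y - W x) (ltac:(lra) : s <= x <= e))
    (ler_wpM2l (ltac:(lra) : 0 <= 3 / 2 :> R) (WL x y sx xy ye)).
  apply: le_trans (ler_normD _ _) _; apply: le_trans (lerD N1 N2) _.
  by rewrite le_eqVlt; apply/orP; left; apply/eqP; rewrite /C; ring.
- by rewrite Ws addr0 (phi_self sys)//; lra.
- move=> c sce.
  have dp : is_derive c (1 : R) (fun x => p + W x) (g c).
    apply: is_derive_eq (is_deriveD (is_derive_cst p c 1) (dW c sce)) _.
    by rewrite add0r.
  apply: is_derive_eq (is_derive_mulmx (phi_is_derive ts _ _) dp) _; [lra|lra|].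
  by rewrite mulmxA /g phi_cancel//; lra.
Qed.

End ConstantControl.
End Existence.

(** * Splitting and extending trajectories *)

Section ReachableSets.
Context {R : realType} {n m : nat}.
Implicit Types (A : R -> 'M[R]_n) (B : R -> 'M[R]_(n, m)).

Lemma measurable_completed (D : set R) : measurable D ->
  measurable (D : set (g_sigma_algebraType
    (completed_algebra_gen (@lebesgue_measure R)))).
Proof.
move=> mD; apply: sub_sigma_algebra; exists D => //.
by exists set0; [exact: negligible_set0|rewrite setU0].
Qed.

Lemma lebesgue_measurable_on_append (k : nat) (a b c : R)
    (u : R -> 'cV[R]_k) (v : 'cV[R]_k) : a <= b -> b <= c ->
  lebesgue_measurable_on `[a, b] u ->
  lebesgue_measurable_on `[a, c] (fun s => if s <= b then u s else v).
Proof.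
move=> ab bc mu j.
have -> : `[a, c]%classic = `[a, b]%classic `|` `]b, c]%classic.
  apply/seteqP; split=> x /=; rewrite !in_itv /=.
    by case: (leP x b) => ? ?; [left|right]; lra.
  by case; lra.
apply/measurable_funU; [exact: measurable_completed|exact: measurable_completed|].
split.
  apply: eq_measurable_fun (mu j) => x.
  by rewrite inE /= in_itv /= => /andP[_ ->].
apply: (eq_measurable_fun (cst (v j 0))); last exact: measurable_cst.
by move=> x; rewrite inE /= in_itv /= => /andP[bx _]; rewrite leNgt bx.
Qed.

Lemma solution_append A B (a b c : R) (p : 'cV[R]_n) u (v : 'cV[R]_m)
    (x z : R -> 'cV[R]_n) : a <= b -> b <= c ->
  is_solution A B a b a p u x -> absolutely_continuous b c z -> z b = x b ->
  (forall s, b < s < c -> is_derive s (1 : R) z (A s *m z s + B s *m v)) ->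
  is_solution A B a c a p (fun s => if s <= b then u s else v)
    (fun s => if s <= b then x s else z s).
Proof.
move=> ab bc [acx xa dx] acz zb dz; split.
- apply: (@ac_glue _ _ a b c) => //.
    by apply: ac_ext acx => s /andP[_ ->].
  apply: ac_ext acz => s /andP[bs sc]; case: leP => // sb.
  by have -> : s = b by lra.
- by rewrite ab.
- have neb : {ae (@lebesgue_measure R), forall s : R, s <> b}.
    exists [set b]; split => //=; first by rewrite lebesgue_measure_set1.
    by move=> s /= /contrapT.
  apply: ae_imply2 dx neb => s Hx /eqP sb sac.
  have [lsb|bs] := leP s b.
    have sb' : s < b by rewrite lt_neqAle sb.
    apply: near_eq_is_derive (Hx _); last first.
      by move: sac; rewrite !in_itv /= => /andP[-> _].
    near=> y; rewrite ifT//; apply: ltW; near: y.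
    exact: lt_nbhsl.
  apply: near_eq_is_derive (dz s _); last first.
    by move: sac; rewrite !in_itv /= bs => /andP[_ ->].
  near=> y; rewrite leNgt ifF//; apply/negbTE; rewrite negbK; near: y.
  exact: lt_nbhsr.
Unshelve. all: by end_near. Qed.

Lemma reach_start A B (t0 : R) (X0 : set 'cV[R]_n) (U : set 'cV[R]_m) v y :
  X0 y -> U v -> reach A B t0 X0 U t0 y.
Proof.
move=> Xy Uv; exists y, (fun=> v), (fun=> y); split => //.
split=> //.
  apply: (@ac_lipschitz _ _ _ _ _ 0) => // s t *.
  by rewrite subrr normr0 mul0r.
by apply: aeW => t; rewrite in_itv /= => ?; exfalso; lra.
Qed.

End ReachableSets.

Section Reachability.
Context {R : realType} {n m q : nat}.
Variables (t0 tf : R) (A dA : R -> 'M[R]_n) (B dB : R -> 'M[R]_(n, m)).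
Variables (MA MdA MB MdB : R) (phi : R -> R -> 'M[R]_n).
Hypothesis sys : regular_system t0 tf A dA B dB MA MdA MB MdB phi.
Variables (X0 : set 'cV[R]_n) (c0 : 'cV[R]_m) (G : 'M[R]_(m, q)).
Local Notation U := (zonotope c0 G).
Local Notation nU := (setnorm U).
Local Notation al := (alpha nU MA MB MdB).

Lemma reach_response s t te y : t0 <= s -> s <= t -> t <= te -> te <= tf ->
  reach A B t0 X0 U t y -> exists x v,
    [/\ reach A B t0 X0 U s x, U v &
        `|y - phi t s *m x - (t - s) *: (B te *m v)| <= al (te - s)].
Proof.
move=> ts st tte tef [x0 [u [x [Xx0 mu uU [acx xt0 dx] ->]]]].
have [|||v Uv vx] := control_response sys (x := x) (u := u) (c0 := c0) (G := G) ts st tte tef.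
- exact: ac_restrict acx.
- apply: ae_imply dx => c Hc cst; apply: Hc.
  by move: cst; rewrite !in_itv /=; lra.
- by move=> c cst; apply: uU; rewrite in_itv /=; lra.
exists (x s), v; split => //.
exists x0, u, x; split => //.
- move=> j; apply: measurable_funS (mu j); first exact: measurable_completed.
  by move=> c /=; rewrite !in_itv /=; lra.
- by move=> c; rewrite in_itv /= => ?; apply: uU; rewrite in_itv /=; lra.
- split => //; first exact: ac_restrict acx.
  apply: ae_imply dx => c Hc cst; apply: Hc.
  by move: cst; rewrite !in_itv /=; lra.
Qed.

(** The constant control [v] ranges over the degenerate zonotope [{v}], for which
    the mean control in [control_response] can only be [v]. *)
Lemma reach_extend s e y v : t0 <= s -> s <= e -> e <= tf ->
  expR ((e - s) * MA) <= 3 / 2 -> reach A B t0 X0 U s y -> U v ->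
  exists2 y', reach A B t0 X0 U e y' &
    `|y' - phi e s *m y - (e - s) *: (B e *m v)| <= al (e - s).
Proof.
move=> ts se et small [x0 [u [x [Xx0 mu uU solx ->]]]] Uv.
have [z [acz zs dz]] := constant_control_solution sys v ts se et small (x s).
exists (z e).
  exists x0, (fun r => if r <= s then u r else v), (fun r => if r <= s then x r else z r).
  split => //.
  - exact: lebesgue_measurable_on_append.
  - move=> r; rewrite in_itv /= => re; case: leP => // rs.
    by apply: uU; rewrite in_itv /=; lra.
  - exact: solution_append.
  - by case: leP => // es; rewrite (_ : e = s)//; lra.
have Z := zonotope_nonempty v (0 : 'M[R]_(m, 0)).
have [||v'] := control_response sys (x := z) (u := fun=> v) (c0 := v)
    (G := (0 : 'M[R]_(m, 0))) ts se (lexx e) et acz.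
- by apply: aeW => c; rewrite in_itv /= => /dz.
- by move=> c _.
rewrite zs => /zonotopeP[? _ ->]; rewrite mul0mx addr0 => H; apply: le_trans H _.
have tt : t0 <= tf by lra.
have MA0 := rs_MA_gt0 sys.
have := MB_ge0 sys tt; have := MdB_ge0 sys tt => ? ?.
rewrite /alpha ler_wpM2r ?divr_ge0 ?addr_ge0 ?mulr_ge0 ?(ltW MA0)//.
rewrite ler_wpM2l ?rfun_ge0//; apply: ge_sup; first by exists `|v|, v.
move=> _ [w /zonotopeP[? _ ->] <-]; rewrite mul0mx addr0.
exact: zonotope_setnorm.
Qed.

End Reachability.

(** * One step of the algorithm on zonotopes *)

Section StepZonotopes.
Context {R : realType} {n m p q : nat}.
Variables (b : 'cV[R]_n) (F : 'M[R]_(n, p)) (c : 'cV[R]_m) (G : 'M[R]_(m, q)).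
Variables (P : 'M[R]_n) (Q : 'M[R]_(n, m)) (h r : R).
Hypothesis r_ge0 : 0 <= r.
Local Notation b' := (P *m b + h *: (Q *m c)).
Local Notation F' := (P *m F).
Local Notation K := (h *: (Q *m G)).

Lemma step_zonotopeP y :
  zonotope b' (row_mx F' (row_mx K (r%:M : 'M[R]_n))) y <->
  exists x v, [/\ zonotope b F x, zonotope c G v &
                  `|y - (P *m x + h *: (Q *m v))| <= r].
Proof.
have E (x : 'cV[R]_p) (z : 'cV[R]_q) : b' + F' *m x + K *m z =
    P *m (b + F *m x) + h *: (Q *m (c + G *m z)).
  by rewrite !mulmxDr scalerDr -scalemxAl !mulmxA [RHS]addrACA [RHS]addrA.
split.
  move=> /zonotope_row_mx[x x1 /zonotope_row_mx[z z1]].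
  move=> /(zonotope_scalar_mx _ _ r_ge0); rewrite E => yr.
  exists (b + F *m x), (c + G *m z); split => //; apply/zonotopeP.
    by exists x.
  by exists z.
move=> [_ [_ [/zonotopeP[x x1 ->] /zonotopeP[z z1 ->] yr]]].
apply/zonotope_row_mx; exists x => //; apply/zonotope_row_mx; exists z => //.
by apply/(zonotope_scalar_mx _ _ r_ge0); rewrite E.
Qed.

Local Notation encl := (enclosure (b, F) (b', F')).
Local Notation Z := (zonotope encl.1
  (row_mx encl.2 (row_mx K (r%:M : 'M[R]_n)))).

Lemma enclosureP y : Z y <-> exists x l w z,
  [/\ `|x| <= 1, `|l| <= 1, `|w| <= 1, `|z| <= 1 &
    `|y - (2^-1 *: (b + b') + 2^-1 *: ((F + F') *m x)
       + (l / 2) *: (b - b') + 2^-1 *: ((F - F') *m w) + K *m z)| <= r].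
Proof.
have E (x w : 'cV[R]_p) (l : 'cV[R]_1) (z : 'cV[R]_q) :
    encl.1 + encl.2 *m col_mx x (col_mx l w) + K *m z =
    2^-1 *: (b + b') + 2^-1 *: ((F + F') *m x)
       + (l 0 0 / 2) *: (b - b') + 2^-1 *: ((F - F') *m w) + K *m z.
  rewrite /enclosure /= !mul_row_col !addrA -!scalemxAl.
  rewrite [l]mx11_scalar mul_mx_scalar scalerA mxE eqxx mulr1n.
  by rewrite (mulrC (l 0 0)).
split.
  move=> /zonotope_row_mx[x x1 /zonotope_row_mx[z z1]].
  move=> /(zonotope_scalar_mx _ _ r_ge0).
  rewrite -(vsubmxK x) -(vsubmxK (dsubmx x)) E => yr.
  exists (usubmx x), (usubmx (dsubmx x) 0 0), (dsubmx (dsubmx x)), z; split => //.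
  - exact: le_trans (norm_usubmx_le _) x1.
  - apply: le_trans (cV_entry_le _ _) _; apply: le_trans (norm_usubmx_le _) _.
    exact: le_trans (norm_dsubmx_le _) x1.
  - apply: le_trans (norm_dsubmx_le _) _.
    exact: le_trans (norm_dsubmx_le _) x1.
move=> [x [l [w [z [x1 l1 w1 z1 yr]]]]].
apply/zonotope_row_mx; exists (col_mx x (col_mx l%:M w)).
  do 2!apply: norm_col_mx_le => //.
  by apply: cV_norm_le => // i; rewrite ord1 mxE eqxx mulr1n.
apply/zonotope_row_mx; exists z => //.
by apply/(zonotope_scalar_mx _ _ r_ge0); rewrite E mxE eqxx mulr1n.
Qed.

(** If [x = b + F *m x'] and [v = c + G *m z], the interpolated point has the
    coefficients [x'] for [F + F'], [1 - 2 l] for [b - b'], [(1 - 2 l) x'] for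
    [F - F'] and [l z] for [K]. *)
Lemma enclosure_contains x v l y : zonotope b F x -> zonotope c G v ->
  0 <= l <= 1 ->
  `|y - ((1 - l) *: x + l *: (P *m x + h *: (Q *m v)))| <= r -> Z y.
Proof.
move=> /zonotopeP[x' x1 ->] /zonotopeP[z z1 ->] l01 yr; apply/enclosureP.
have l1 : `|1 - 2 * l| <= 1 by rewrite ler_norml; lra.
exists x', (1 - 2 * l), ((1 - 2 * l) *: x'), (l *: z); split => //.
- rewrite normrZ -[leRHS]mulr1; exact: ler_pM.
- rewrite normrZ ger0_norm; last by lra.
  by apply: mulr_ile1 => //; lra.
apply: le_trans yr; rewrite le_eqVlt; apply/orP; left; apply/eqP.
congr (`|_ - _|).
rewrite !mulmxDr !mulmxBl !mulmxDl -!scalemxAr -!scalemxAl !mulmxA.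
move: (F *m x') (P *m F *m x') (P *m b) (Q *m c) (Q *m G *m z) => u1 u2 u3 u4 u5.
by apply/matrixP => i j; rewrite !mxE; field.
Qed.

(** The point [b + F *m x] with the coefficients [x] of [F + F'] is close to [y]:
    up to [r], their difference is [P - 1] applied to the combination of [b] and
    [F] with the coefficients [(1 - l) / 2] and [(x - w) / 2], plus [h *: Q]
    applied to the combination of [c] and [G] with [(1 - l) / 2] and [z]. *)
Lemma enclosure_near y (k M : R) : 0 <= h ->
  (forall x : 'cV[R]_n, `|P *m x - x| <= k * `|x|) ->
  (forall v : 'cV[R]_m, `|Q *m v| <= M * `|v|) -> 0 <= k -> 0 <= M ->
  Z y -> exists2 x, zonotope b F x &
    `|y - x| <= k * opnorm (row_mx b F) + h * M * opnorm (row_mx c G) + r.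
Proof.
move=> h0 Pk QM k0 M0 /enclosureP[x [l [w [z [x1 l1 w1 z1 yr]]]]].
exists (b + F *m x); first by apply/zonotopeP; exists x.
set Y := (X in y - X) in yr.
pose d1 : 'cV[R]_(1 + p) := col_mx ((1 - l) / 2)%:M (2^-1 *: (x - w)).
pose d2 : 'cV[R]_(1 + q) := col_mx ((1 - l) / 2)%:M z.
have sc : `|((1 - l) / 2)%:M : 'cV[R]_1| <= 1.
  apply: cV_norm_le => // i; rewrite ord1 mxE eqxx mulr1n ler_norml.
  by move: l1; rewrite ler_norml; lra.
have d11 : `|d1| <= 1.
  apply: norm_col_mx_le => //; rewrite normrZ ger0_norm ?invr_ge0//.
  by have := ler_normB x w; lra.
have d21 : `|d2| <= 1 by exact: norm_col_mx_le.
have E : Y - (b + F *m x) = (P *m (row_mx b F *m d1) - row_mx b F *m d1)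
    + h *: (Q *m (row_mx c G *m d2)).
  rewrite /d1 /d2 !mul_row_col !mul_mx_scalar /Y.
  rewrite !mulmxDr !mulmxBl !mulmxDl -!scalemxAr -!scalemxAl !mulmxBr !mulmxA.
  move: (F *m x) (P *m F *m x) (P *m b) (Q *m c) (Q *m G *m z) (F *m w)
    (P *m F *m w) => u1 u2 u3 u4 u5 u6 u7.
  by apply/matrixP => i j; rewrite !mxE; field.
have -> : y - (b + F *m x) = (y - Y) + (Y - (b + F *m x)) by rewrite addrA subrK.
have D1 := norm_mulmx_le_trans (lexx (opnorm (row_mx b F))) d11.
have D2 := norm_mulmx_le_trans (lexx (opnorm (row_mx c G))) d21.
rewrite mulr1 in D1; rewrite mulr1 in D2.
apply: le_trans (ler_normD _ _) _; rewrite [leRHS]addrC lerD// E.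
apply: le_trans (ler_normD _ _) _; rewrite lerD//.
  by apply: le_trans (Pk _) _; rewrite ler_wpM2l.
rewrite normrZ ger0_norm// -mulrA ler_wpM2l//.
by apply: le_trans (QM _) _; rewrite ler_wpM2l.
Qed.

Lemma step_opnorm (k M : R) : 0 <= h ->
  (forall x : 'cV[R]_n, `|P *m x| <= k * `|x|) ->
  (forall v : 'cV[R]_m, `|Q *m v| <= M * `|v|) -> 0 <= k -> 0 <= M ->
  opnorm (row_mx b' (row_mx F' (row_mx K (r%:M : 'M[R]_n)))) <=
    k * opnorm (row_mx b F) + h * M * opnorm (row_mx c G) + r.
Proof.
move=> h0 Pk QM k0 M0; apply: opnorm_le => [|v v1].
  by rewrite !addr_ge0// !mulr_ge0// ?opnorm_ge0.
set l := usubmx v; set x := usubmx (dsubmx v).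
set z := usubmx (dsubmx (dsubmx v)); set w := dsubmx (dsubmx (dsubmx v)).
have v1' : `|dsubmx v| <= 1 := le_trans (norm_dsubmx_le _) v1.
have v1'' : `|dsubmx (dsubmx v)| <= 1 := le_trans (norm_dsubmx_le _) v1'.
have l1 : `|l| <= 1 := le_trans (norm_usubmx_le _) v1.
have x1 : `|x| <= 1 := le_trans (norm_usubmx_le _) v1'.
have z1 : `|z| <= 1 := le_trans (norm_usubmx_le _) v1''.
have w1 : `|w| <= 1 := le_trans (norm_dsubmx_le _) v1''.
have -> : row_mx b' (row_mx F' (row_mx K (r%:M : 'M[R]_n))) *m v =
    P *m (row_mx b F *m col_mx l x) + h *: (Q *m (row_mx c G *m col_mx l z))
    + r *: w.
  rewrite -[in LHS](vsubmxK v) -[in LHS](vsubmxK (dsubmx v)).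
  rewrite -[in LHS](vsubmxK (dsubmx (dsubmx v))) -/l -/x -/z -/w.
  rewrite !mul_row_col mul_scalar_mx !addrA; congr (_ + _).
  rewrite !mulmxDr !mulmxDl scalerDr -!scalemxAl !mulmxA.
  by rewrite [RHS]addrACA [RHS]addrA.
have D1 := norm_mulmx_le_trans (lexx (opnorm (row_mx b F))) (norm_col_mx_le l1 x1).
have D2 := norm_mulmx_le_trans (lexx (opnorm (row_mx c G))) (norm_col_mx_le l1 z1).
rewrite mulr1 in D1; rewrite mulr1 in D2.
apply: le_trans (ler_normD _ _) _; apply: lerD; last first.
  by rewrite normrZ ger0_norm// ler_piMr.
apply: le_trans (ler_normD _ _) _; apply: lerD.
  by apply: le_trans (Pk _) _; rewrite ler_wpM2l.
rewrite normrZ ger0_norm// -mulrA ler_wpM2l//.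
by apply: le_trans (QM _) _; rewrite ler_wpM2l.
Qed.

End StepZonotopes.

(** * Containment of the reachable sets *)

Section Grid.
Context {R : realType}.
Variables (t0 tf : R) (N : nat).
Local Notation h := (stepsize t0 tf N).
Local Notation nd := (node t0 tf N).

Lemma stepsize_gt0 : t0 < tf -> (0 < N)%N -> 0 < h.
Proof. by move=> tt N0; rewrite divr_gt0 ?subr_gt0 ?ltr0n. Qed.

Lemma node0 : nd 0 = t0.
Proof. by rewrite /node mul0r addr0. Qed.

Lemma nodeS i : nd i.+1 = nd i + h.
Proof. by rewrite /node -natr1 mulrDl mul1r addrA. Qed.

Lemma steps_le i : t0 < tf -> (i <= N)%N -> i%:R * h <= tf - t0.
Proof.
move=> tt iN; have [->|] := posnP i; first by rewrite mul0r subr_ge0 ltW.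
move=> i0; have N0 : (0 < N)%N := leq_trans i0 iN.
have -> : tf - t0 = N%:R * h.
  by rewrite /stepsize mulrC divfK// pnatr_eq0 -lt0n.
by rewrite ler_wpM2r ?ler_nat// ltW ?stepsize_gt0.
Qed.

Lemma node_itv i : t0 < tf -> (i <= N)%N -> t0 <= nd i <= tf.
Proof.
move=> tt iN; have := steps_le tt iN.
have : 0 <= i%:R * h.
  have [->|i0] := posnP i; first by rewrite mul0r.
  by rewrite mulr_ge0// ltW// stepsize_gt0// (leq_trans i0).
rewrite /node; lra.
Qed.

End Grid.

Section Tube.
Context {R : realType} {n m p q : nat}.
Variables (t0 tf : R) (A dA : R -> 'M[R]_n) (B dB : R -> 'M[R]_(n, m)).
Variables (MA MdA MB MdB : R) (phi : R -> R -> 'M[R]_n).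
Hypothesis sys : regular_system t0 tf A dA B dB MA MdA MB MdB phi.
Hypothesis t0_lt_tf : t0 < tf.
Variables (phit : R -> R -> 'M[R]_n) (theta : R -> R).
Hypothesis theta_ge0 : forall h, 0 <= h -> 0 <= theta h.
Hypothesis phit_approx : forall t s, t0 <= s -> s <= t -> t <= tf ->
  opnorm (phi t s - phit t s) <= theta (t - s).
Variables (a : 'cV[R]_n) (E : 'M[R]_(n, p)) (c : 'cV[R]_m) (G : 'M[R]_(m, q)).
Local Notation X0 := (zonotope a E).
Local Notation U := (zonotope c G).
Local Notation nU := (setnorm U).
Local Notation al := (alpha nU MA MB MdB).
Local Notation be := (beta nU MdB).
Local Notation ga := (gamma MA MdA).

Let MA_gt0 : 0 < MA. Proof. exact: rs_MA_gt0 sys. Qed.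

Let MA_ge0 : 0 <= MA. Proof. exact: ltW. Qed.

Let MdA0 : 0 <= MdA. Proof. exact: MdA_ge0 sys (ltW t0_lt_tf). Qed.

Let MB0 : 0 <= MB. Proof. exact: MB_ge0 sys (ltW t0_lt_tf). Qed.

Let MdB0 : 0 <= MdB. Proof. exact: MdB_ge0 sys (ltW t0_lt_tf). Qed.

Let nU0 : 0 <= nU. Proof. exact: setnorm_zonotope_ge0. Qed.

Lemma alpha_ge0 h : 0 <= al h.
Proof.
by rewrite /alpha !mulr_ge0 ?rfun_ge0 ?addr_ge0 ?mulr_ge0 ?invr_ge0 ?exprn_ge0.
Qed.

Lemma beta_ge0 h : 0 <= be h.
Proof. by apply: mulr_ge0 => //; apply: mulr_ge0 => //; exact: sqr_ge0. Qed.

Lemma gamma_ge0 h : 0 <= ga h.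
Proof. by rewrite /gamma mulr_ge0 ?rfun_ge0 ?addr_ge0 ?divr_ge0 ?exprn_ge0. Qed.

(** The constants of the convergence rate, [D] being the constant of
    [small_step_rates]: the growth rate of [1 + m_i], the resulting bound for all
    [m_i], the growth rate of the distance from a node zonotope to the reachable
    set, and the final factor of [h]. *)
Definition size_growth (D : R) : R := 4 * D + MB * opnorm (row_mx c G).

Definition size_limit (D : R) : R :=
  (opnorm (row_mx a E) + 1) * expR (size_growth D * (tf - t0)).

Definition node_rate (D : R) : R := 2 * D + 2 * D * size_limit D + D.

Definition tube_rate (D : R) : R :=
  2 * D * size_limit D + MB * opnorm (row_mx c G) + (2 * D + 2 * D * size_limit D)
  + expR (node_rate D * (tf - t0)).

Variable N : nat.
Local Notation h := (stepsize t0 tf N).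
Local Notation nd := (node t0 tf N).
Local Notation P i := (phit (nd i.+1) (nd i)).
Local Notation bFi i := (bF t0 tf B phit theta al a E c G N i).
Local Notation Om i := (zonotope (bFi i).1 (bFi i).2).
Local Notation mm i := (opnorm (row_mx (bFi i).1 (bFi i).2)).
Local Notation Lam i := (Lambda t0 tf B phit theta al be ga a E c G N i).
Local Notation reachable := (reach A B t0 X0 U).

Section OneStep.
Variable i : nat.
Hypothesis iN : (i < N)%N.

Lemma step_geometry :
  [/\ 0 < h, t0 <= nd i, nd i.+1 = nd i + h & nd i.+1 <= tf].
Proof.
have N0 : (0 < N)%N by exact: leq_trans iN.
have /andP[? _] := node_itv t0_lt_tf (ltnW iN).
have /andP[_ ?] := node_itv t0_lt_tf iN.
by split => //; [exact: stepsize_gt0|exact: nodeS].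
Qed.

Lemma phit_step (x : 'cV[R]_n) : `|phi (nd i.+1) (nd i) *m x - P i *m x| <= theta h * `|x|.
Proof.
have [h0 ti ii it] := step_geometry.
rewrite -mulmxBl; apply: norm_mulmx_le_trans => //.
have hE : nd i.+1 - nd i = h by rewrite ii addrC addKr.
by rewrite -[in leRHS]hE; apply: phit_approx => //; lra.
Qed.

Lemma radius_ge0 : 0 <= al h + theta h * mm i.
Proof.
have [h0 _ _ _] := step_geometry.
by rewrite addr_ge0 ?alpha_ge0// mulr_ge0 ?opnorm_ge0// theta_ge0// ltW.
Qed.

Lemma tube_radius_ge0 : 0 <= al h + be h + (ga h + theta h) * mm i.
Proof.
have [h0 _ _ _] := step_geometry.
by rewrite !addr_ge0 ?alpha_ge0 ?beta_ge0// mulr_ge0 ?opnorm_ge0// addr_ge0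
  ?gamma_ge0// theta_ge0// ltW.
Qed.

Lemma Om_succP y : Om i.+1 y <-> exists x v, [/\ Om i x, U v &
  `|y - (P i *m x + h *: (B (nd i.+1) *m v))| <= al h + theta h * mm i].
Proof. exact: (step_zonotopeP _ _ _ _ _ _ _ radius_ge0). Qed.

(** Compared with [Om_succP]: [control_response] replaces the true response to
    the control by [h *: (B (nd i.+1) *m v)], and [theta] accounts for [phit]. *)
Lemma node_containment_step :
  reachable (nd i) `<=` Om i -> reachable (nd i.+1) `<=` Om i.+1.
Proof.
move=> IH y ry; have [h0 ti ii it] := step_geometry.
have [x [v [rx Uv yx]]] := reach_response sys ti (ltac:(lra) : nd i <= nd i.+1)
  (lexx _) it ry.
apply/Om_succP; exists x, v; split => //; first exact: IH.
have hE : nd i.+1 - nd i = h by rewrite ii addrC addKr.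
rewrite hE in yx.
have -> : y - (P i *m x + h *: (B (nd i.+1) *m v)) =
    (y - phi (nd i.+1) (nd i) *m x - h *: (B (nd i.+1) *m v))
    + (phi (nd i.+1) (nd i) *m x - P i *m x).
  move: (P i *m x) (h *: _) (phi (nd i.+1) (nd i) *m x) => u1 u2 u3.
  by apply/matrixP => k j; rewrite !mxE; ring.
apply: le_trans (ler_normD _ _) _; rewrite lerD//.
apply: le_trans (phit_step x) _; rewrite ler_wpM2l ?theta_ge0 ?(ltW h0)//.
exact/zonotope_norm_le/IH.
Qed.

(** Between the nodes the free motion is the interpolation of its end values up to
    [ga h], and the control contributes [l * h] times a velocity [B v], where [l]
    is the elapsed fraction of the step: this is [enclosure_contains]. *)
Lemma tube_containment_step : reachable (nd i) `<=` Om i ->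
  reach_tube A B t0 X0 U (nd i) (nd i.+1) `<=` Lam i.+1.
Proof.
move=> IH y [s /=]; rewrite in_itv /= => /andP[is_ si] ry.
have [h0 ti ii it] := step_geometry.
have hE : nd i.+1 - nd i = h by rewrite ii addrC addKr.
have [x [v [rx Uv]]] := reach_response sys ti is_ si it ry; rewrite hE => yx.
have Ox := IH _ rx.
pose l := (s - nd i) / h.
have sl : s - nd i = l * h by rewrite /l divfK// gt_eqF.
have l0 : 0 <= l by rewrite divr_ge0 ?subr_ge0// ltW.
have l1 : l <= 1 by rewrite ler_pdivrMr// mul1r; lra.
have l01 : 0 <= l <= 1 by rewrite l0.
apply: (enclosure_contains tube_radius_ge0 Ox Uv l01).
have := phi_interpolation sys x ti (ltac:(lra) : nd i <= nd i.+1) it l01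
  (t := s); rewrite hE => /(_ sl) interp.
move: (B (nd i.+1) *m v) yx => Bv yx.
have -> : y - ((1 - l) *: x + l *: (P i *m x + h *: Bv)) =
  (y - phi s (nd i) *m x - (s - nd i) *: Bv)
  + (phi s (nd i) *m x - ((1 - l) *: x + l *: (phi (nd i.+1) (nd i) *m x)))
  + l *: (phi (nd i.+1) (nd i) *m x - P i *m x).
  rewrite sl; move: (phi s (nd i) *m x) (phi (nd i.+1) (nd i) *m x) (P i *m x).
  by move=> u1 u2 u3; apply/matrixP => k j; rewrite !mxE; ring.
have xm : `|x| <= mm i := zonotope_norm_le Ox.
have th0 : 0 <= theta h := theta_ge0 (ltW h0).
have N1 := le_trans interp (ler_wpM2l (gamma_ge0 h) xm).
have N2 : `|l *: (phi (nd i.+1) (nd i) *m x - P i *m x)| <= theta h * mm i.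
  rewrite normrZ ger0_norm//; apply: le_trans (ler_piMl (normr_ge0 _) l1) _.
  by apply: le_trans (phit_step x) _; rewrite ler_wpM2l.
apply: le_trans (ler_normD _ _) _.
have := ler_normD (y - phi s (nd i) *m x - (s - nd i) *: Bv)
  (phi s (nd i) *m x - ((1 - l) *: x + l *: (phi (nd i.+1) (nd i) *m x))).
have := beta_ge0 h; rewrite mulrDl; move: (theta h * mm i) (ga h * mm i) N1 N2 yx => *; lra.
Qed.

End OneStep.

Lemma node_containment i : (i <= N)%N -> reachable (nd i) `<=` Om i.
Proof.
elim: i => [_|i IH iN].
  by rewrite node0 => y [x0 [u [x [Xx0 _ _ [_ xt _] ->]]]]; rewrite xt.
by apply: node_containment_step => //; exact/IH/ltnW.
Qed.

Lemma tube_containment i : (i < N)%N ->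
  reach_tube A B t0 X0 U (nd i) (nd i.+1) `<=` Lam i.+1.
Proof. by move=> iN; apply: tube_containment_step => //; exact/node_containment/ltnW. Qed.


(** * Convergence rate *)

Section Rates.
Variables D h0 : R.
Hypothesis D_ge0 : 0 <= D.
Hypothesis h0_le1 : h0 <= 1.
Hypothesis small : forall k, 0 < k -> k <= h0 ->
  [/\ expR (k * MA) <= 3 / 2, expR (k * MA) <= 1 + D * k,
      theta k <= D * k ^+ 2 &
      [/\ al k <= D * k ^+ 2, be k <= D * k ^+ 2 & ga k <= D * k ^+ 2]].
Hypothesis N_gt0 : (0 < N)%N.
Hypothesis h_le : h <= h0.

Let h_gt0 : 0 < h. Proof. exact: stepsize_gt0. Qed.
Let sq_le : h ^+ 2 <= h.
Proof. by rewrite expr2 ler_piMl ?(ltW h_gt0)// (le_trans h_le). Qed.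
Let sq_ge0 : 0 <= h ^+ 2. Proof. exact: sqr_ge0. Qed.
Let Dh_ge0 : 0 <= D * h. Proof. exact: mulr_ge0 D_ge0 (ltW h_gt0). Qed.
Let th_ge0 : 0 <= theta h. Proof. exact/theta_ge0/ltW. Qed.

Local Notation k0 := (opnorm (row_mx c G)).
Let k0_ge0 : 0 <= k0. Proof. exact: opnorm_ge0. Qed.

Lemma phi_step_bound i (x : 'cV[R]_n) : (i < N)%N ->
  `|phi (nd i.+1) (nd i) *m x| <= (1 + D * h) * `|x|.
Proof.
move=> iN; have [hp ti ii it] := step_geometry iN.
have ii' : nd i <= nd i.+1 by rewrite ii; lra.
apply: le_trans (phi_gronwall sys x ti ii' it) _; rewrite ler_wpM2r//.
have -> : nd i.+1 - nd i = h by rewrite ii addrC addKr.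
by have [] := small h_gt0 h_le.
Qed.

Lemma phit_step_bound i (x : 'cV[R]_n) : (i < N)%N ->
  `|P i *m x| <= (1 + 2 * D * h) * `|x|.
Proof.
move=> iN; have := ler_normB (phi (nd i.+1) (nd i) *m x)
  (phi (nd i.+1) (nd i) *m x - P i *m x).
rewrite opprB addrC subrK => H; apply: le_trans H _.
have := phi_step_bound x iN; have H1 := phit_step iN x.
have [_ _ th _] := small h_gt0 h_le.
have th2 : theta h <= D * h by apply: le_trans th _; rewrite ler_wpM2l.
have := ler_wpM2r (normr_ge0 x) th2; lra.
Qed.

Lemma phit_step_near_id i (x : 'cV[R]_n) : (i < N)%N ->
  `|P i *m x - x| <= 2 * D * h * `|x|.
Proof.
move=> iN; have [hp ti ii it] := step_geometry iN.
have ii' : nd i <= nd i.+1 by rewrite ii; lra.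
have tin : t0 <= nd i <= tf by lra.
have := phi_increment sys x ti (lexx _) ii' it.
have -> : nd i.+1 - nd i = h by rewrite ii addrC addKr.
rewrite subrr mul0r expR0 (phi_self sys)// => H1.
have H2 := phit_step iN x.
have [_ eD th _] := small h_gt0 h_le.
have th2 : theta h <= D * h by apply: le_trans th _; rewrite ler_wpM2l.
have := ler_wpM2r (normr_ge0 x) th2.
have := ler_wpM2r (normr_ge0 x) eD.
have := ler_normB (phi (nd i.+1) (nd i) *m x - x)
  (phi (nd i.+1) (nd i) *m x - P i *m x).
have -> : phi (nd i.+1) (nd i) *m x - x - (phi (nd i.+1) (nd i) *m x - P i *m x)
    = P i *m x - x.
  by rewrite opprB addrC addrA subrK.
lra.
Qed.

Local Notation L1 := (size_growth D).
Let L1_ge0 : 0 <= L1.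
Proof. by rewrite /size_growth addr_ge0 ?mulr_ge0. Qed.

(** Adding 1 makes the affine recursion for [m_i] multiplicative. *)
Lemma size_step i : (i < N)%N -> mm i.+1 + 1 <= (1 + L1 * h) * (mm i + 1).
Proof.
move=> iN; have [hp ti ii it] := step_geometry iN.
have D0 := D_ge0; have MB0' := MB0.
have qB (v : 'cV[R]_m) : `|B (nd i.+1) *m v| <= MB * `|v|.
  by apply: (norm_B_le sys); rewrite ii; lra.
have := step_opnorm (bFi i).1 (bFi i).2 c G (radius_ge0 iN) (ltW hp)
  (fun x => phit_step_bound x iN) qB.
have Dh0 := Dh_ge0.
have kp : 0 <= 1 + 2 * D * h by lra.
move=> /(_ kp MB0) H.
have [_ _ th [alD _ _]] := small h_gt0 h_le.
have th2 : theta h <= D * h by apply: le_trans th _; rewrite ler_wpM2l.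
have al2 : al h <= D * h by apply: le_trans alD _; rewrite ler_wpM2l.
have m0 : 0 <= mm i := opnorm_ge0 _.
have th3 := ler_wpM2r m0 th2.
have Mk0 : 0 <= MB * k0 * h * mm i.
  exact: mulr_ge0 (mulr_ge0 (mulr_ge0 MB0 k0_ge0) (ltW hp)) m0.
have Dhm0 : 0 <= D * h * mm i by rewrite mulr_ge0.
apply: le_trans (lerD H (lexx 1)) _; rewrite /size_growth.
move: (mm i) (theta h * mm i) (al h) k0 m0 th3 Mk0 Dhm0 al2 => *; lra.
Qed.

Local Notation Mm := (size_limit D).

Lemma size_bound i : (i <= N)%N ->
  mm i <= Mm.
Proof.
move=> iN.
have H j : (j <= N)%N -> mm j + 1 <= (mm 0 + 1) * expR (L1 * (j%:R * h)).
  elim: j => [_|j IH jN]; first by rewrite mul0r mulr0 expR0 mulr1.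
  apply: le_trans (size_step jN) _.
  have -> : L1 * (j.+1%:R * h) = L1 * h + L1 * (j%:R * h).
    by rewrite -natr1; ring.
  rewrite expRD [leRHS]mulrCA; apply: ler_pM.
  - exact: addr_ge0 ler01 (mulr_ge0 L1_ge0 (ltW h_gt0)).
  - by rewrite addr_ge0// opnorm_ge0.
  - exact: expR_ge1Dx.
  - exact/IH/ltnW.
have := H i iN; have : expR (L1 * (i%:R * h)) <= expR (L1 * (tf - t0)).
  by rewrite ler_expR ler_wpM2l// steps_le.
rewrite /size_limit -[opnorm (row_mx a E)]/(mm 0).
have m0 : 0 <= mm 0 + 1 by rewrite addr_ge0// opnorm_ge0.
move=> /(ler_wpM2l m0); lra.
Qed.

Let Mm_ge0 : 0 <= Mm.
Proof. by rewrite /size_limit mulr_ge0 ?expR_ge0// addr_ge0// opnorm_ge0. Qed.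
Local Notation L2 := (node_rate D).
Let L2_ge0 : 0 <= L2.
Proof.
have D2 : 0 <= 2 * D := mulr_ge0 (ler0n _ 2) D_ge0.
exact: addr_ge0 (addr_ge0 D2 (mulr_ge0 D2 Mm_ge0)) D_ge0.
Qed.

(** The distance [e_i] to the reachable set satisfies
    [e_(i+1) <= (1 + D h) e_i + O(h ^+ 2)], where the first term carries the old
    error through [phi] and the second collects [theta] for [y'] and [al] for the
    constant control on top of the radius of the zonotope. The bound
    [h (exp (L h i) - 1)] absorbs both as soon as [L >= D] dominates the constant
    in the second term. *)
Lemma node_accuracy i y : (i <= N)%N -> Om i y ->
  exists2 x, reachable (nd i) x & `|y - x| <= h * (expR (L2 * (i%:R * h)) - 1).
Proof.
elim: i y => [|i IH] y iN.
  move=> /= Xy; exists y; last by rewrite subrr normr0 mul0r mulr0 expR0 subrr mulr0.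
  by rewrite node0; exact: reach_start Xy (zonotope_nonempty c G).
move=> /(Om_succP iN)[y' [v [Oy' Uv yr]]].
have [x' rx' yx'] := IH y' (ltnW iN) Oy'.
have [hp ti ii it] := step_geometry iN.
have ii' : nd i <= nd i.+1 by rewrite ii; lra.
have hE : nd i.+1 - nd i = h by rewrite ii addrC addKr.
have [eh eD th [alD _ _]] := small h_gt0 h_le.
have [|x rx] := reach_extend sys ti ii' it _ rx' Uv; first by rewrite hE.
rewrite hE => xr; exists x => //.
have y'm : `|y'| <= Mm := le_trans (zonotope_norm_le Oy') (size_bound (ltnW iN)).
have D1 : `|phi (nd i.+1) (nd i) *m y' - P i *m y'| <= D * h ^+ 2 * Mm.
  by apply: le_trans (phit_step iN y') _; apply: ler_pM.
have D2 : theta h * mm i <= D * h ^+ 2 * Mm.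
  by apply: ler_pM => //; [exact: opnorm_ge0|exact/size_bound/ltnW].
have D3 := phi_step_bound (y' - x') iN.
have e0 := Dh_ge0.
have D4 := ler_wpM2l (ltac:(lra) : 0 <= 1 + D * h) yx'.
move: (B (nd i.+1) *m v) yr xr => Bv yr xr.
have -> : y - x = (y - (P i *m y' + h *: Bv))
    - (phi (nd i.+1) (nd i) *m y' - P i *m y')
    + phi (nd i.+1) (nd i) *m (y' - x')
    - (x - phi (nd i.+1) (nd i) *m x' - h *: Bv).
  rewrite mulmxBr.
  move: (P i *m y') (phi (nd i.+1) (nd i) *m y') (phi (nd i.+1) (nd i) *m x').
  by move=> u1 u2 u3; apply/matrixP => k j; rewrite !mxE; ring.
set X1 := y - _ in yr *; set X2 := _ - P i *m y' in D1 *.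
set X3 := phi _ _ *m (y' - x') in D3 *; set X4 := x - _ - _ in xr *.
have T1 := ler_normB (X1 - X2 + X3) X4.
have T2 := ler_normD (X1 - X2) X3.
have T3 := ler_normB X1 X2.
set e1 := expR (L2 * (i%:R * h)) in D4.
have e1_ge1 : 1 <= e1.
  have := expR_ge1Dx (L2 * (i%:R * h)); rewrite -/e1.
  have : 0 <= L2 * (i%:R * h).
    exact: mulr_ge0 L2_ge0 (mulr_ge0 (ler0n _ _) (ltW h_gt0)).
  lra.
have step : (1 + L2 * h) * e1 <= expR (L2 * (i.+1%:R * h)).
  have -> : L2 * (i.+1%:R * h) = L2 * h + L2 * (i%:R * h).
    by rewrite -natr1; ring.
  by rewrite expRD ler_wpM2r ?expR_ge0// expR_ge1Dx.
apply: (@le_trans _ _ (h * ((1 + L2 * h) * e1 - 1))); last first.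
  by rewrite ler_wpM2l ?(ltW h_gt0)// lerD2r.
have Q1 : (L2 - D) * h ^+ 2 <= (L2 - D) * h ^+ 2 * e1.
  rewrite ler_peMr// mulr_ge0// /node_rate.
  have : 0 <= D * Mm by rewrite mulr_ge0.
  by have := D_ge0; lra.
have Q2 : 0 <= D * h ^+ 2 by rewrite mulr_ge0.
have D3' := le_trans D3 D4.
have E2 : (L2 - D) * h ^+ 2 = 2 * (D * h ^+ 2) + 2 * (D * h ^+ 2 * Mm).
  by rewrite /node_rate; ring.
have E3 : h * ((1 + L2 * h) * e1 - 1) = (1 + D * h) * (h * (e1 - 1))
    + D * h ^+ 2 + (L2 - D) * h ^+ 2 * e1 by ring.
rewrite E3.
move: E2 Q1 D1 D2 D3' yr xr T1 T2 T3 alD Q2.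
move: (`|X1|) (`|X2|) (`|X3|) (`|X4|) (`|X1 - X2|) (`|X1 - X2 + X3|)
  (`|X1 - X2 + X3 - X4|) => ? ? ? ? ? ? ?.
move: (D * h ^+ 2 * Mm) ((L2 - D) * h ^+ 2 * e1) ((L2 - D) * h ^+ 2) => ? ? ?.
move: (theta h * mm i) (al h) (D * h ^+ 2) ((1 + D * h) * _) => *; lra.
Qed.

(** A point of [Lam i.+1] is compared with the zonotope of the node [i], whose
    reachable set belongs to the tube. *)
Lemma tube_accuracy i y : (i < N)%N -> Lam i.+1 y ->
  exists2 x, reach_tube A B t0 X0 U (nd i) (nd i.+1) x & `|y - x| <= tube_rate D * h.
Proof.
move=> iN Ly; have [hp ti ii it] := step_geometry iN.
have qB (v : 'cV[R]_m) : `|B (nd i.+1) *m v| <= MB * `|v|.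
  by apply: (norm_B_le sys); rewrite ii; lra.
have Dh0 := Dh_ge0; have kp : 0 <= 2 * D * h by lra.
have [x Ox yx] := enclosure_near (tube_radius_ge0 iN) (ltW hp)
  (fun x => phit_step_near_id x iN) qB kp MB0 Ly.
have [z rz xz] := node_accuracy (ltnW iN) Ox; exists z.
  by exists (nd i) => //=; rewrite in_itv /= lexx ii; lra.
have [_ _ th [alD beD gaD]] := small h_gt0 h_le.
have mM : mm i <= Mm := size_bound (ltnW iN).
have m0 : 0 <= mm i := opnorm_ge0 _.
have Dh : D * h ^+ 2 <= D * h by rewrite ler_wpM2l.
have R1 : 2 * D * h * mm i <= 2 * D * h * Mm by rewrite ler_wpM2l.
have R2 : (ga h + theta h) * mm i <= 2 * (D * h) * Mm.
  apply: ler_pM => //; first by rewrite addr_ge0 ?gamma_ge0.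
  lra.
have R3 : h * (expR (L2 * (i%:R * h)) - 1) <= h * expR (L2 * (tf - t0)).
  rewrite ler_wpM2l ?(ltW h_gt0)//.
  apply: (@le_trans _ _ (expR (L2 * (i%:R * h)))); first by rewrite gerBl.
  by rewrite ler_expR ler_wpM2l// steps_le// ltnW.
have T := ler_normD (y - x) (x - z); rewrite addrA subrK in T.
have -> : tube_rate D * h = 2 * D * h * Mm + h * MB * k0 + (2 * (D * h) + 2 * (D * h) * Mm)
  + h * expR (L2 * (tf - t0)) by rewrite /tube_rate; ring.
move: yx xz R1 R2 R3 T alD beD Dh.
move: (`|y - x|) (`|x - z|) (`|y - z|) => ? ? ?.
move: (2 * D * h * Mm) (2 * D * h * mm i) (2 * (D * h) * Mm) => ? ? ?.
move: ((ga h + theta h) * mm i) (h * MB * k0) (h * expR _) (h * (expR _ - 1)).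
move: (al h) (be h) (D * h ^+ 2) (D * h) => *; lra.
Qed.

End Rates.

End Tube.

(** * Small steps and the Hausdorff distance *)

Lemma expR_le_quadratic (R : realType) (x : R) : 0 <= x <= 1 / 2 ->
  expR x <= 1 + x + 2 * x ^+ 2.
Proof.
move=> /andP[x0 x1].
have H1 : expR x * (1 - x) <= 1.
  have := ler_wpM2l (expR_ge0 x) (expR_ge1Dx (- x)).
  by rewrite -expRD subrr expR0.
have H2 : 0 <= x ^+ 2 * (1 - 2 * x) by rewrite mulr_ge0 ?sqr_ge0//; lra.
have H3 : expR x * (1 - x) <= (1 + x + 2 * x ^+ 2) * (1 - x) by lra.
by rewrite -(@ler_pM2r _ (1 - x))//; lra.
Qed.

Lemma small_step_rates (R : realType) (MA MdA MB MdB nU : R)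
    (theta : R -> R) :
  0 < MA -> 0 <= MdA -> 0 <= MB -> 0 <= MdB -> 0 <= nU ->
  (theta : R^o -> R^o) =O_ (0^'+) (fun h => (h ^+ 2 : R^o)) ->
  exists D h0 : R, [/\ 0 <= D, 0 < h0, h0 <= 1 &
    forall k, 0 < k -> k <= h0 ->
    [/\ expR (k * MA) <= 3 / 2, expR (k * MA) <= 1 + D * k,
      theta k <= D * k ^+ 2 &
      [/\ alpha nU MA MB MdB k <= D * k ^+ 2, beta nU MdB k <= D * k ^+ 2 &
          gamma MA MdA k <= D * k ^+ 2]]].
Proof.
move=> MA0 MdA0 MB0 MdB0 nU0 /eqO_exP[Ct Ct0 ].
rewrite /at_right near_withinE => /nbhs_ballP[d /= d0 Hd].
pose Da := 2 * (nU * (MdB + MA * MB)); pose Dg := 2 * (MA ^+ 2 + MdA).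
have Da0 : 0 <= Da by rewrite !mulr_ge0// addr_ge0// mulr_ge0// ltW.
have Dg0 : 0 <= Dg by rewrite mulr_ge0// addr_ge0// sqr_ge0.
have Db0 : 0 <= MdB * nU by rewrite mulr_ge0.
pose h0 := Num.min 1 (Num.min (d / 2) (1 / (4 * MA))).
exists (2 * MA + Ct + Da + MdB * nU + Dg), h0.
have d20 : 0 < d / 2 by lra.
have MA4 : 0 < 1 / (4 * MA) by rewrite divr_gt0//; lra.
split.
- by lra.
- by rewrite /h0 !lt_min ltr01 d20.
- by rewrite /h0 ge_min lexx.
move=> k k0; rewrite /h0 !le_min => /and3P[k1 kd kM].
have kM0 : 0 <= k * MA by rewrite mulr_ge0// ltW.
have kM4 : k * MA <= 1 / 4.
  have -> : 1 / 4 = 1 / (4 * MA) * MA :> R by field; rewrite gt_eqF.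
  by rewrite ler_pM2r.
have e2 := @expR_le_quadratic R (k * MA) ltac:(lra).
have sq4 : (k * MA) ^+ 2 <= k * MA * (1 / 4) by rewrite expr2 ler_wpM2l.
have r2 : rfun MA k <= 2 * MA ^+ 2 * k ^+ 2.
  by rewrite /rfun -mulrA -exprMn (mulrC MA); lra.
have k20 : 0 <= k ^+ 2 := sqr_ge0 k.
have s1 : 0 <= Ct * k ^+ 2 by rewrite mulr_ge0// ltW.
have s2 : 0 <= Da * k ^+ 2 by rewrite mulr_ge0.
have s3 : 0 <= MdB * nU * k ^+ 2 by rewrite mulr_ge0.
have s4 : 0 <= Dg * k ^+ 2 by rewrite mulr_ge0.
have s5 : 0 <= 2 * MA * k ^+ 2 by rewrite !mulr_ge0// ltW.
split.
- lra.
- have t1 : 0 <= (Ct + Da + MdB * nU + Dg) * k.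
    by rewrite mulr_ge0 ?(ltW k0)// !addr_ge0// ltW.
  lra.
- have := Hd k; rewrite /ball /= sub0r normrN gtr0_norm// => /(_ _ k0)/wrap[].
    by lra.
  move=> H; have := le_trans (ler_norm _) H.
  rewrite [X in Ct * X]ger0_norm//; lra.
split.
- have : alpha nU MA MB MdB k <= Da * k ^+ 2; last by lra.
  have -> : Da * k ^+ 2 = 2 * MA ^+ 2 * k ^+ 2 * nU * ((MdB + MA * MB) / MA ^+ 2).
    by rewrite /Da; field; rewrite gt_eqF.
  rewrite /alpha ler_wpM2r ?divr_ge0 ?addr_ge0 ?mulr_ge0 ?sqr_ge0 ?(ltW MA0)//.
  by rewrite ler_wpM2r.
- by rewrite /beta; lra.
- have : gamma MA MdA k <= Dg * k ^+ 2; last by lra.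
  have -> : Dg * k ^+ 2 = 2 * MA ^+ 2 * k ^+ 2 * (1 + MdA / MA ^+ 2).
    by rewrite /Dg; field; rewrite gt_eqF.
  by rewrite /gamma ler_wpM2r// addr_ge0// divr_ge0// sqr_ge0.
Qed.

Lemma hausdorff_dist_le (R : realType) (k : nat) (S L : set 'cV[R]_k) (e : R) :
  0 < e -> S `<=` L -> (forall y, L y -> exists2 x, S x & `|y - x| <= e) ->
  (hausdorff_dist S L <= e%:E)%E.
Proof.
move=> e0 SL LS; apply: ereal_inf_lbound; exists e => //; split => //.
  move=> y Sy; exists y; first exact: SL.
  by exists 0; rewrite ?scaler0 ?addr0// /unit_ball /= normr0.
move=> y Ly; have [x Sx yx] := LS y Ly; exists x => //.
exists (e^-1 *: (y - x)); last first.
  by rewrite scalerA divff ?gt_eqF// scale1r addrC subrK.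
by rewrite /unit_ball /= normrZ gtr0_norm ?invr_gt0// mulrC ler_pdivrMr// mul1r.
Qed.

Theorem mainTheorem3 (R : realType) (n m p q : nat) (t0 tf : R)
    (X0 : set 'cV[R]_n) (U : set 'cV[R]_m)
    (A dA : R -> 'M[R]_n) (B dB : R -> 'M[R]_(n, m))
    (MA MdA MB MdB : R)
    (phi phit : R -> R -> 'M[R]_n) (theta : R -> R)
    (a : 'cV[R]_n) (E : 'M[R]_(n, p)) (c : 'cV[R]_m) (G : 'M[R]_(m, q))
    (n_gt0 : (0 < n)%N) (m_gt0 : (0 < m)%N) (t0_lt_tf : t0 < tf)
    (A_C1 : is_C1_on t0 tf A dA) (B_C1 : is_C1_on t0 tf B dB)
    (MA_gt0 : 0 < MA)
    (A_bound : forall t, t \in `[t0, tf] -> opnorm (A t) <= MA)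
    (dA_bound : forall t, t \in `[t0, tf] -> opnorm (dA t) <= MdA)
    (B_bound : forall t, t \in `[t0, tf] -> opnorm (B t) <= MB)
    (dB_bound : forall t, t \in `[t0, tf] -> opnorm (dB t) <= MdB)
    (phi_transition : is_transition_matrix A B t0 tf phi)
    (theta_ge0 : forall h, 0 <= h -> 0 <= theta h)
    (theta_incr : forall h k, 0 <= h -> h <= k -> theta h <= theta k)
    (theta_O : (theta : R^o -> R^o) =O_ (0^'+) (fun h => (h ^+ 2 : R^o)))
    (phit_approx : forall t s, t0 <= s -> s <= t -> t <= tf ->
      opnorm (phi t s - phit t s) <= theta (t - s))
    (X0_zonotope : X0 = zonotope a E) (U_zonotope : U = zonotope c G) :
  let Lam (N i : nat) :=
    Lambda t0 tf B phit theta
      (alpha (setnorm U) MA MB MdB) (beta (setnorm U) MdB) (gamma MA MdA)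
      a E c G N i in
  let tube (N i : nat) :=
    reach_tube A B t0 X0 U (node t0 tf N i.-1) (node t0 tf N i) in
  (forall N i : nat, (0 < N)%N -> (0 < i <= N)%N -> tube N i `<=` Lam N i) /\
  (exists C : R, exists N0 : nat, [/\ 0 <= C, (0 < N0)%N &
    forall N i : nat, (N0 <= N)%N -> (0 < i <= N)%N ->
      (hausdorff_dist (tube N i) (Lam N i) <= (C / N%:R)%:E)%E]).
Proof.
move=> Lam tube; rewrite /Lam /tube {Lam tube} U_zonotope X0_zonotope.
have sys : regular_system t0 tf A dA B dB MA MdA MB MdB phi by split.
have incl N i : (i < N)%N ->
    reach_tube A B t0 (zonotope a E) (zonotope c G)
      (node t0 tf N i) (node t0 tf N i.+1) `<=` _ :=
  tube_containment sys t0_lt_tf theta_ge0 phit_approx (a := a) (E := E)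
    (c := c) (G := G) (N := N) (i := i).
split=> [N [//|i] _ /=|]; first exact: incl.
have tle := ltW t0_lt_tf.
have [D [h0 [D0 h00 h01 small]]] := small_step_rates MA_gt0 (MdA_ge0 sys tle)
  (MB_ge0 sys tle) (MdB_ge0 sys tle) (setnorm_zonotope_ge0 c G) theta_O.
pose r := tube_rate t0 tf MB a E c G D.
(* The maximum with 1 makes the radius [C / N] positive, as the definition of the
   Hausdorff distance requires. *)
pose C := Num.max 1 (r * (tf - t0)).
have C0 : 0 < C by rewrite /C lt_max ltr01.
(* From this index on the step size is at most [h0]. *)
exists C, (Num.truncn ((tf - t0) / h0)).+1; split => //; first exact: ltW.
move=> N [//|i] NN /= iN.
have N0 : (0 < N)%N by exact: leq_trans NN.
have hh0 : stepsize t0 tf N <= h0.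
  rewrite /stepsize ler_pdivrMr ?ltr0n// mulrC -ler_pdivrMr//.
  by apply: ltW; rewrite -truncn_lt_nat// divr_ge0 ?subr_ge0// ltW.
apply: hausdorff_dist_le; [by rewrite divr_gt0// ltr0n|exact: incl|].
move=> y Ly; have [x tx yx] := tube_accuracy sys t0_lt_tf theta_ge0 phit_approx
  D0 h01 small N0 hh0 iN Ly.
exists x => //; apply: le_trans yx _; rewrite -/r /stepsize mulrA.
by rewrite ler_pM2r ?invr_gt0 ?ltr0n// /C le_max lexx orbT.
Qed.
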